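(* Let $g\in\mathbb R^d$. Assume that $\underline f$ and $\underline\sigma$ are bounded by some constant $C$ uniformly in $x\in\mathbb R^d$, and let $M$ be an upper bound of $\|g\|$. Then there exists $K=K(C,M)>0$ such that, for all $v\in\mathcal C^2_{\rm b}([0,T]\times\mathbb R^d)$ and all $(t,x)\in\mathcal T_h\times\mathbb R^d$, \begin{align*} &\Big|(\underline\sigma(x)g)\cdot Dv(t,x)-\mathbb E\big[(v(t+h,\hat X(t+h))-v(t,x))\,\mathcal P^1_g(h^{-1}W^t_h)\mid\hat X(t)=x\big]\Big|\\ &\le K(1+\sqrt h)^2\Big[\sqrt h\big(|\partial_t^1D^0v|+|\partial_t^0D^1v|+|\partial_t^0D^2v|\big)+h\,|\partial_t^1D^1v|+h\sqrt h\,|\partial_t^2D^0v|\Big]. \end{align*}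
   Context: $T>0$, $d\ge1$, and $h>0$ is a time step such that $T/h$ is an integer; $\mathcal T_h=\{0,h,2h,\dots,T-h\}$. The constant $K$ does not depend on $h$, $t$, $x$, $v$ (the dimension $d$ is fixed). $(W_s)_{s\ge0}$ is a $d$-dimensional Brownian motion and $W^t_h:=W_{t+h}-W_t$. $\underline f:\mathbb R^d\to\mathbb R^d$ and $\underline\sigma:\mathbb R^d\to\mathbb R^{d\times d}$ are given, and $\hat X$ is the Euler scheme $$\hat X(t+h)=\hat X(t)+\underline f(\hat X(t))h+\underline\sigma(\hat X(t))(W_{t+h}-W_t).$$ For $\mu\in\mathbb R^d$, $\mu_+,\mu_-\in\mathbb R^d$ are defined by $[\mu_+]_i=\max([\mu]_i,0)$ and $[\mu_-]_i=-\min([\mu]_i,0)$, where $[\mu]_i$ is the $i$th coordinate. For $g,w\in\mathbb R^d$, $$\mathcal P^1_g(w)=2\,(g_+\cdot w_++g_-\cdot w_-).$$ $\mathcal C^k_{\rm b}([0,T]\times\mathbb R^d)$ is the set of functions $[0,T]\times\mathbb R^d\to\mathbb R$ with continuous and bounded partial derivatives up to order $k$ in $t$ and $x$. $D$ is the gradient in $x$. For integers $p,q\ge 0$, $$|\partial_t^pD^q\phi|=\sup_{(t,x)\in[0,T]\times\mathbb R^d,\ \beta\in\mathbb N^d,\ \sum_i\beta_i=q}\Big|\frac{\partial^{p+q}\phi}{\partial t^p\partial x_1^{\beta_1}\cdots\partial x_d^{\beta_d}}(t,x)\Big|.$$ $\|\cdot\|$ denotes any fixed norm on $\mathbb R^d$.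 *)

(* Defs.v *)
From HB Require Import structures.
From mathcomp Require Import all_boot all_order all_algebra.
From mathcomp Require Import all_classical all_reals all_analysis.
Set Implicit Arguments.
Unset Strict Implicit.
Unset Printing Implicit Defensive.
Import Order.TTheory GRing.Theory Num.Theory.
Import numFieldNormedType.Exports.
Local Open Scope classical_set_scope.
Local Open Scope ring_scope.

(* Vectors of R^d are column matrices. *)

(* Matrices carry the Borel sigma-algebra of their usual topology. *)
Definition borel_mx_display : measure_display. Proof. by constructor. Qed.

Section borel_mx.
Variables (R : realType) (m n : nat).

Definition borel_mx : set (set 'M[R]_(m, n)) := <<s [set A | open A] >>.

Let borel_mx0 : borel_mx set0.
Proof. exact: sigma_algebra0. Qed.

Let borel_mxC A : borel_mx A -> borel_mx (~` A).
Proof. by rewrite -setTD; exact: sigma_algebraCD. Qed.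

Let borel_mx_bigcup (A : (set 'M[R]_(m, n))^nat) :
  (forall i, borel_mx (A i)) -> borel_mx (\bigcup_i A i).
Proof. exact: sigma_algebra_bigcup. Qed.

HB.instance Definition _ := @isMeasurable.Build borel_mx_display
  'M[R]_(m, n) borel_mx borel_mx0 borel_mxC borel_mx_bigcup.
End borel_mx.

Section algebra.
Variable R : realType.

Definition is_norm (V : lmodType R) (N : V -> R) : Prop :=
  [/\ forall x, N x = 0 -> x = 0,
      forall a x, N (a *: x) = `|a| * N x &
      forall x y, N (x + y) <= N x + N y].

Variable d : nat.
Implicit Types u w g : 'cV[R]_d.

Definition dotp u w : R := \sum_(i < d) u i 0 * w i 0.

Definition pos_part u : 'cV[R]_d := \col_i Num.max (u i 0) 0.
Definition neg_part u : 'cV[R]_d := \col_i - Num.min (u i 0) 0.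

Definition P1 g w : R :=
  2 * (dotp (pos_part g) (pos_part w) + dotp (neg_part g) (neg_part w)).

End algebra.

(* Functions [0, T] x R^d -> R are represented by v : R -> 'cV[R]_d -> R, of
   which only the values at times in [0, T] are ever used. *)
Section partial_derivatives.
Variables (R : realType) (d : nat) (T : R).
Implicit Types (v : R -> 'cV[R]_d -> R) (t : R) (x : 'cV[R]_d).

(* The time derivative is taken relatively to [0, T], hence it is one-sided
   at 0 and at T. *)
Definition time_quotient v t x (s : R) : R := (s - t)^-1 * (v s x - v t x).

(* A variable is None (the time t) or Some i (the coordinate x_i). *)
Definition ex_pderiv (a : option 'I_d) v t x : Prop :=
  match a with
  | None => cvg (time_quotient v t x @ within `[0, T] t^')
  | Some i => derivable (v t) x (delta_mx i 0)
  end.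

Definition pderiv (a : option 'I_d) v t x : R :=
  match a with
  | None => lim (time_quotient v t x @ within `[0, T] t^')
  | Some i => 'D_(delta_mx i 0) (v t) x
  end.

(* The head of the word is the variable of the last derivation. *)
Definition pderivs (s : seq (option 'I_d)) v : R -> 'cV[R]_d -> R :=
  foldr pderiv v s.

(* C^k_b([0, T] x R^d); the derivative of order 0 is v itself. *)
Definition Cb (k : nat) v : Prop :=
  (forall a s, (size s < k)%N -> forall t x, t \in `[0, T] ->
    ex_pderiv a (pderivs s v) t x) /\
  (forall s, (size s <= k)%N ->
    {within `[0, T] `*` [set: 'cV[R]_d],
      continuous (fun z : R * 'cV[R]_d => pderivs s v z.1 z.2)} /\
    exists B : R, forall t x, t \in `[0, T] -> `|pderivs s v t x| <= B).

Definition grad v t x : 'cV[R]_d := \col_i pderiv (Some i) v t x.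

(* d^(p+q) / dt^p dx_1^(b_1) ... dx_d^(b_d) *)
Definition mixed_word (p : nat) (b : 'I_d -> nat) : seq (option 'I_d) :=
  nseq p None ++ flatten [seq nseq (b i) (Some i) | i <- enum 'I_d].

(* |d_t^p D^q v|; the set below is bounded as soon as Cb (p + q) v. *)
Definition seminorm (p q : nat) v : R :=
  sup [set r | exists t x (b : 'I_d -> nat),
    [/\ t \in `[0, T], (\sum_(i < d) b i)%N = q &
        r = `|pderivs (mixed_word p b) v t x|]].

End partial_derivatives.

Section stochastic.
Variables (R : realType) (d : nat) (disp : measure_display).
Variables (Omega : measurableType disp) (P : probability Omega R).
Implicit Types (F : R -> set (set Omega)) (W X : R -> Omega -> 'cV[R]_d).

(* Only the times s >= 0 matter. *)
Definition is_filtration F : Prop :=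
  [/\ forall s : R, 0 <= s -> sigma_algebra setT (F s),
      forall s : R, 0 <= s -> F s `<=` measurable &
      forall r s : R, 0 <= r -> r <= s -> F r `<=` F s].

Definition rv_in (G : set (set Omega)) (Z : Omega -> 'cV[R]_d) : Prop :=
  forall B, measurable B -> G (Z @^-1` B).

(* d-dimensional Brownian motion with respect to F (for instance its natural
   filtration, possibly enlarged by an independent initial condition):
   W_s - W_r is independent of F_r and has law N(0, (s - r) I_d).
   The second argument of normal_prob is the standard deviation. *)
Definition is_brownian F W : Prop :=
  [/\ {ae P, forall w, W 0 w = 0},
      {ae P, forall w, {within `[0, +oo[, continuous (W ^~ w)}},
      forall s : R, 0 <= s -> rv_in (F s) (W s),
      forall r s : R, 0 <= r -> r < s -> forall A B, F r A -> measurable B ->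
        P (A `&` (W s \- W r) @^-1` B) =
        (P A * P ((W s \- W r)%R @^-1` B))%E &
      forall r s : R, 0 <= r -> r < s -> forall B : 'I_d -> set R,
        (forall i, measurable (B i)) ->
        P [set w | forall i, B i ((W s w - W r w) i 0)] =
        (\prod_(i < d) normal_prob 0 (Num.sqrt (s - r)) (B i))%E].

(* T_h = {0, h, 2h, ..., T - h} *)
Definition grid (T h : R) : set R :=
  [set t | exists2 k : nat, t = k%:R * h & t <= T - h].

(* Euler scheme from time t on, with an arbitrary non-anticipative state at
   time t: this covers the schemes started before t, as well as the schemes
   started at t from a deterministic point. *)
Definition euler_from F W (T h : R) (f : 'cV[R]_d -> 'cV[R]_d)
    (sigma : 'cV[R]_d -> 'M[R]_d) (t : R) X : Prop :=
  rv_in (F t) (X t) /\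
  forall s, grid T h s -> t <= s -> forall w,
    X (s + h) w =
    X s w + h *: f (X s w) + sigma (X s w) *m (W (s + h) w - W s w).

(* m is a version of z |-> E[Y | Z = z]. *)
Definition is_condE (Z : Omega -> 'cV[R]_d) (Y : Omega -> R)
    (m : 'cV[R]_d -> R) : Prop :=
  [/\ P.-integrable setT (EFin \o Y),
      measurable_fun setT m,
      P.-integrable setT (EFin \o (m \o Z)) &
      forall B, measurable B ->
        (\int[P]_(w in Z @^-1` B) (Y w)%:E =
         \int[P]_(w in Z @^-1` B) (m (Z w))%:E :> \bar R)%E].

(* m is the function z |-> E[Y(X) | X(t) = z] for the Markov chain X.
   A version for one given law of X(t) is only determined almost everywhere;
   requiring that m be a version for all the laws of X(t) determines m at every
   point, see euler_condE_unique. *)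
Definition euler_condE F W (T h : R) (f : 'cV[R]_d -> 'cV[R]_d)
    (sigma : 'cV[R]_d -> 'M[R]_d) (t : R)
    (Y : (R -> Omega -> 'cV[R]_d) -> Omega -> R) (m : 'cV[R]_d -> R) : Prop :=
  forall X, euler_from F W T h f sigma t X -> is_condE (X t) (Y X) m.

Lemma euler_from_exists F W (T h : R) f sigma t x :
  is_filtration F -> 0 < h -> grid T h t ->
  exists X, euler_from F W T h f sigma t X /\ forall w, X t w = x.
Proof.
move=> [salgF _ _] h0 [j tE _].
have t0 : 0 <= t by rewrite tE mulr_ge0// ltW.
pose Z := fix Z (n : nat) (w : Omega) : 'cV[R]_d := if n is n'.+1 then
  let s := t + n'%:R * h in
  Z n' w + h *: f (Z n' w) + sigma (Z n' w) *m (W (s + h) w - W s w) else x.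
pose X s := Z (Num.truncn ((s - t) / h)).
have XZ n : X (t + n%:R * h) = Z n.
  by rewrite /X addrAC subrr add0r mulfK ?gt_eqF// natrK.
have Xt : X t = Z 0 by rewrite -(XZ 0%N) mul0r addr0.
exists X; split=> [|w]; last by rewrite Xt.
split=> [B mB|s [k sE _] ts w].
  rewrite Xt /=; have [F0 FC _] := salgF _ t0.
  have [Bx|nBx] := pselect (B x).
    rewrite (_ : _ @^-1` B = setT); last by apply/seteqP; split.
    by rewrite -(setD0 setT); exact: FC.
  by rewrite (_ : _ @^-1` B = set0)//; apply/seteqP; split.
have jk : (j <= k)%N by rewrite -(ler_nat R) -(ler_pM2r h0) -tE -sE.
have {}sE : s = t + (k - j)%:R * h.
  by rewrite tE sE -mulrDl -natrD subnKC.
have sE1 : s + h = t + (k - j).+1%:R * h.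
  by rewrite sE -natr1 mulrDl mul1r addrA.
by rewrite [in LHS]sE1 XZ /= -sE [in X s]sE XZ.
Qed.

Lemma euler_condE_unique F W (T h : R) f sigma t Y m1 m2 :
  is_filtration F -> 0 < h -> grid T h t ->
  euler_condE F W T h f sigma t Y m1 -> euler_condE F W T h f sigma t Y m2 ->
  m1 = m2.
Proof.
move=> fF h0 gt E1 E2; apply/funext => x.
have [X [eX Xt]] := @euler_from_exists F W T h f sigma t x fF h0 gt.
have [_ _ _ /(_ setT measurableT) I1] := E1 X eX.
have [_ _ _ /(_ setT measurableT) I2] := E2 X eX.
have cst m : (\int[P]_(w in X t @^-1` setT) (m (X t w))%:E)%E = (m x)%:E.
  under eq_integral do rewrite Xt.
  by rewrite preimage_setT integral_cst// [X in (_ * X)%E](_ : _ = 1%E) ?mule1//;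
    exact: probability_setT.
by move: I2; rewrite I1 !cst => -[].
Qed.

End stochastic.

(* Main.v *)
Require Import Defs.
From HB Require Import structures.
From mathcomp Require Import all_boot all_order all_algebra.
From mathcomp Require Import all_classical all_reals all_analysis.
From mathcomp Require Import measurable_realfun ring lra.
Import Order.TTheory GRing.Theory Num.Theory.
Import numFieldNormedType.Exports.
Local Open Scope classical_set_scope.
Local Open Scope ring_scope.

(** Write [u] for the square root of [h], [D] for the Brownian increment over
    the step, [S] for the sum of the [|D_i| / u], and [xi] for the Euler
    increment [h f(x) + sigma(x) D].  The weight [P1 g (D / h)] is bounded by a
    constant times [S / u], so everything of order [h] in the increment of [v]
    contributes an error of order [u] only, and the term of order [u], which is
    linear in [D], has to be integrated exactly.

    That term is handled by [mean_increment_weight]: [E (D_i P1 g (D / h))] is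
    [g_i].  The terms of the weight with [j <> i] vanish because [D_i] is
    centred and independent of [D_j]; for [j = i] the mean of [x max(x, 0)] under
    [N(0, h)] is half of the variance, the mean of [- x min(x, 0)] is minus this
    half, and the factor 2 of the weight turns the difference of the positive
    and negative parts of [g_i] into [g_i].

    The remaining terms ([one_step_remainder_le]) are the increment of [v] in
    time, at most [h |d_t v|] by the mean value theorem; the drift, at most
    [h d L |D v|]; and the second order Taylor remainder in space, at most
    [|D^2 v| (sum |xi_i|)^2].  As [sum |xi_i|] is at most
    [d L u (1 + u) (1 + S)], the product of these terms with the weight is
    bounded by [u (1 + u)^2 (|d_t v| + |D v| + |D^2 v|)] times a multiple of
    [(1 + S)^3], whose mean is bounded independently of [h]
    ([normal_vector_cube_moment]).

    Finally [D] is independent of the state at time [t], so the conditional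
    expectation given that state [z] is the plain mean with [z] frozen, by
    Fubini ([is_condE_indep]).  Taking [z = x] gives the estimate. *)

(** * Norms on spaces of matrices *)

Lemma is_norm_ge0 {R : realType} {V : lmodType R} (N : V -> R) :
  is_norm N -> forall x, 0 <= N x.
Proof.
move=> [_ Nz Nt] x.
have N0 : N 0 = 0 by rewrite -(scale0r 0) Nz normr0 mul0r.
have := Nt x (- x); rewrite subrr N0 -[in N (- x)]scaleN1r Nz normrN1 mul1r.
by lra.
Qed.

Lemma is_norm_rV_continuous {R : realType} {n} (N : 'rV[R]_n -> R) :
  is_norm N -> continuous N.
Proof.
move=> Nn; have [_ Nz Nt] := Nn; have N0 := is_norm_ge0 _ Nn.
have N00 : N 0 = 0 by rewrite -(scale0r 0) Nz normr0 mul0r.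
pose B := \sum_j N (delta_mx 0 j).
have B0 : 0 <= B by exact: sumr_ge0.
have NB x : N x <= B * `|x|.
  rewrite [in leLHS](row_sum_delta x).
  have : N (\sum_j x 0 j *: delta_mx 0 j) <= \sum_j `|x 0 j| * N (delta_mx 0 j).
    elim/big_ind2 : _ => [|a b c e ab ce|j _]; first by rewrite N00.
      by apply: le_trans (Nt _ _) _; exact: lerD.
    by rewrite Nz.
  move/le_trans; apply; rewrite /B mulr_suml; apply: ler_sum => j _.
  rewrite mulrC ler_wpM2l//.
  by rewrite [leRHS]/Num.Def.normr /= mx_normrE; apply/bigmax_geP; right;
    exists (0, j).
move=> x; have Fx : Filter (nbhs x) := nbhs_filter x.
apply/(cvgrPdist_lt (FF := Fx)) => e e0.
apply/(@nbhs_normP R 'rV[R]_n).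
exists (e / (B + 1)) => /= [|y /= xy]; first by rewrite divr_gt0// ltr_wpDl.
have Nd : `|N x - N y| <= N (x - y).
  have h1 := Nt (x - y) y; have h2 := Nt (y - x) x.
  rewrite !subrK in h1 h2.
  have h3 : N (y - x) = N (x - y).
    by rewrite -[y - x]opprB -[in LHS]scaleN1r Nz normrN1 mul1r.
  by rewrite ler_norml; apply/andP; split; lra.
apply: le_lt_trans Nd _; apply: le_lt_trans (NB _) _.
move: xy; rewrite ltr_pdivlMr ?ltr_wpDl// => h.
by apply: le_lt_trans h; rewrite mulrC ler_wpM2l// lerDl.
Qed.

(** On a finite-dimensional space the given norm is bounded below on the
    compact unit sphere of the maximum norm, hence it dominates the entries. *)
Lemma is_norm_dominates_entries {R : realType} {m n} (N : 'M[R]_(m, n) -> R) :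
  is_norm N -> exists2 c : R, 0 <= c &
    forall (A : 'M[R]_(m, n)) i j, `|A i j| <= c * N A.
Proof.
move=> Nn; have [Nd Nz Nt] := Nn.
pose N' (x : 'rV[R]_(m * n)) := N (vec_mx x).
have N'n : is_norm N'.
  split=> [x /Nd /(canRL vec_mxK)|a x|x y].
  - by rewrite linear0.
  - by rewrite /N' linearZ Nz.
  - by rewrite /N' linearD Nt.
have [N'd N'z N't] := N'n.
suff [c c0 H] : exists2 c : R, 0 <= c & forall x, `|x| <= c * N' x.
  exists c => // A i j; have := H (mxvec A); rewrite /N' mxvecK;
    apply: le_trans.
  rewrite -mxvecE [leRHS]/Num.Def.normr /= mx_normrE; apply/bigmax_geP; right.
  by exists (0, mxvec_index i j).
pose S := [set x : 'rV[R]_(m * n) | `|x| = 1].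
have [S0|S0] := pselect (S !=set0); last first.
  exists 0 => // x; rewrite mul0r; have [->|x0] := eqVneq x 0;
    first by rewrite normr0.
  exfalso; apply: S0; exists (`|x|^-1 *: x).
  by rewrite /S /= normrZ normfV normr_id mulVf// normr_eq0.
have cS : compact S.
  apply: bounded_closed_compact.
    by exists 1; split => // M M1 x Sx; rewrite /= [leLHS]Sx ltW.
  rewrite (_ : S = ((fun x : ('rV[R]_(m * n))%type => `|x|) @^-1` [set 1]));
    last by [].
  apply: closed_comp => [x _|]; [exact: norm_continuous | exact: closed_eq].
have [x0 /set_mem Sx0 xm] := EVT_min_rV S0 cS
  (continuous_subspaceT (is_norm_rV_continuous _ N'n)).
have p0 : 0 < N' x0.
  rewrite lt_neqAle is_norm_ge0// andbT eq_sym; apply/eqP => /N'd x00.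
  by move: Sx0; rewrite /S /= x00 normr0 => /eqP; rewrite eq_sym oner_eq0.
exists (N' x0)^-1 => [|x]; first by rewrite invr_ge0 ltW.
have [->|xn0] := eqVneq x 0; first by rewrite normr0 mulr_ge0// ?invr_ge0
  ?is_norm_ge0// ltW.
have nx : 0 < `|x| by rewrite normr_gt0.
have := xm (`|x|^-1 *: x); rewrite N'z normfV normr_id => H.
rewrite mulrC ler_pdivlMr// mulrC -ler_pdivlMr// mulrC; apply: H.
by apply/mem_set; rewrite /S /= normrZ normfV normr_id mulVf// gt_eqF.
Qed.

(** * Taylor expansion along the coordinates *)

Section coordinatewise_taylor.
Context {R : realType} {d : nat}.
Implicit Types (F : 'cV[R]_d -> R) (x xi : 'cV[R]_d).

Lemma MVT_coord F x (i : 'I_d) (a : R) :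
  (forall y, derivable F y (delta_mx i 0)) ->
  exists2 b : R, `|b| <= `|a| &
    F (x + a *: delta_mx i 0) - F x =
    a * 'D_(delta_mx i 0) F (x + b *: delta_mx i 0).
Proof.
set e := delta_mx i 0 => dF; pose G (s : R) := F (x + s *: e).
have qE (s : R) : (fun h : R => h^-1 *: (G (h *: (1 : R) + s) - G s)) =
            (fun h => h^-1 *: (F (h *: e + (x + s *: e)) - F (x + s *: e))).
  apply/funext => h; rewrite /G; congr (_ *: (F _ - _)).
  by rewrite [h *: 1]mulr1 scalerDl addrCA.
have dG (s : R) : is_derive s (1 : R) G ('D_e F (x + s *: e)).
  split; first by rewrite /derivable qE; exact: dF.
  by rewrite /derive qE.
have cG (u w : R) : {within `[u, w], continuous G}.
  apply: derivable_within_continuous => s _; exact: ex_derive.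
have G0 : G 0 = F x by rewrite /G scale0r addr0.
have [a0|a0] := leP 0 a.
  have [c] := MVT_segment a0 (fun s _ => dG s) (cG 0 a).
  rewrite in_itv /= => /andP[c0 ca] E; exists c; first by rewrite !ger0_norm.
  by rewrite -G0 -/(G a) E subr0 mulrC.
have [c] := MVT_segment (ltW a0) (fun s _ => dG s) (cG a 0).
rewrite in_itv /= => /andP[c0 ca] E; exists c.
  by rewrite !ler0_norm ?lerN2// ltW.
by rewrite -G0 -/(G a) -opprB E sub0r mulrN opprK mulrC.
Qed.

(** The corner reached from [x] after moving along the first [n] coordinates
    of [xi]: the increment of a function from [x] to [x + xi] is split along
    these corners, so that only one-dimensional mean values are involved. *)
Definition corner x xi (n : nat) : 'cV[R]_d :=
  x + \col_i (if (i < n)%N then xi i 0 else 0).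

Lemma corner0 x xi : corner x xi 0 = x.
Proof.
by rewrite /corner (_ : \col__ _ = 0) ?addr0//; apply/colP => i; rewrite !mxE.
Qed.

Lemma corner_full x xi : corner x xi d = x + xi.
Proof.
rewrite /corner; congr (_ + _).
by apply/colP => i; rewrite mxE ltn_ord.
Qed.

Lemma cornerS x xi (i : 'I_d) :
  corner x xi i.+1 = corner x xi i + xi i 0 *: delta_mx i 0.
Proof.
rewrite /corner -addrA; congr (_ + _); apply/colP => j; rewrite !mxE eqxx andbT.
rewrite ltnS leq_eqVlt -val_eqE; case: ltngtP => //=; rewrite ?mulr0 ?addr0//.
by move=> /val_inj ->; rewrite mulr1 add0r.
Qed.

(** The mean value theorem is applied between consecutive corners. *)
Lemma corner_increment_le F x xi (n : nat) (B : R) : (n <= d)%N ->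
  (forall (i : 'I_d) y, (i < n)%N -> derivable F y (delta_mx i 0)) ->
  (forall (i : 'I_d) y, (i < n)%N -> `|'D_(delta_mx i 0) F y| <= B) ->
  `|F (corner x xi n) - F x| <= B * \sum_(i < d | (i < n)%N) `|xi i 0|.
Proof.
elim: n => [|n IH] nd dF DB.
  by rewrite corner0 subrr normr0 big_pred0 ?mulr0.
pose i := Ordinal nd.
have [b _] := MVT_coord F (corner x xi i) i (xi i 0)
  (fun y => dF i y (ltnSn n)).
rewrite -cornerS /= => E.
rewrite -(subrK (F (corner x xi n)) (F (corner x xi n.+1))) E -addrA.
apply: le_trans (ler_normD _ _) _.
rewrite (bigD1 i) ?ltnSn//= mulrDr lerD//.
  by rewrite normrM mulrC ler_wpM2r// DB ?ltnSn.
rewrite (eq_bigl (fun j : 'I_d => (j < n)%N)) => [|j].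
  by apply: IH => [|j y jn|j y jn]; [exact: ltnW|apply: dF|apply: DB];
    exact: ltnW.
by rewrite ltnS -val_eqE /= [RHS]ltn_neqAle andbC.
Qed.

Lemma sum_norm_ord_le (n : nat) xi :
  \sum_(i < d | (i < n)%N) `|xi i 0| <= \sum_(i < d) `|xi i 0|.
Proof.
by rewrite [leRHS](bigID (fun i : 'I_d => (i < n)%N)) /= lerDl sumr_ge0.
Qed.

(** Each step along a coordinate is an exact first order increment, taken at
    an intermediate point; replacing that point by [x] costs one more increment.
    As the coordinates are visited in increasing order, the second derivatives
    met on the way are the [D_j (D_i F)] with [j <= i], which is the order of
    derivation that a mixed word prescribes. *)
Lemma coordinatewise_taylor2 F x xi (B : R) : 0 <= B ->
  (forall (i : 'I_d) y, derivable F y (delta_mx i 0)) ->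
  (forall (j i : 'I_d) y, (j <= i)%N ->
    derivable (fun z => 'D_(delta_mx i 0) F z) y (delta_mx j 0)) ->
  (forall (j i : 'I_d) y, (j <= i)%N ->
    `|'D_(delta_mx j 0) (fun z => 'D_(delta_mx i 0) F z) y| <= B) ->
  `|F (x + xi) - F x - \sum_(i < d) xi i 0 * 'D_(delta_mx i 0) F x|
  <= B * (\sum_(i < d) `|xi i 0|) ^+ 2.
Proof.
move=> B0 dF ddF DB; set S := \sum_(i < d) `|xi i 0|.
suff H n : (n <= d)%N -> `|F (corner x xi n) - F x
     - \sum_(i < d | (i < n)%N) xi i 0 * 'D_(delta_mx i 0) F x|
     <= B * S * \sum_(i < d | (i < n)%N) `|xi i 0|.
  have := H d (leqnn d); rewrite corner_full expr2 mulrA.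
  by rewrite !(eq_bigl _ _ (fun i : 'I_d => ltn_ord i)).
elim: n => [|n IH] nd.
  by rewrite corner0 subrr !big_pred0// subr0 normr0 mulr0.
pose i := Ordinal nd.
have [b bx] := MVT_coord F (corner x xi i) i (xi i 0) (dF i).
rewrite -cornerS /= => E.
have split_sum (G : 'I_d -> R) : \sum_(j < d | (j < n.+1)%N) G j =
    G i + \sum_(j < d | (j < n)%N) G j.
  rewrite (bigD1 i) ?ltnSn//=; congr (_ + _); apply: eq_bigl => j.
  by rewrite ltnS -val_eqE /= [RHS]ltn_neqAle andbC.
rewrite !split_sum [leRHS]mulrDr.
pose D := 'D_(delta_mx i 0) F.
rewrite (_ : _ - _ = xi i 0 * (D (corner x xi n + b *: delta_mx i 0) - D x) +
   (F (corner x xi n) - F x - \sum_(j < d | (j < n)%N) xi j 0 *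
     'D_(delta_mx j 0) F x)); last first.
  by rewrite -[F (corner x xi n.+1)](subrK (F (corner x xi n))) E -/(D _)
    -/(D x); ring.
apply: le_trans (ler_normD _ _) _; rewrite lerD//; last exact: IH (ltnW nd).
rewrite normrM mulrC ler_wpM2r//.
(* the intermediate point is itself a corner, of an increment cut at [i] *)
pose xi' := \col_j (if j == i then b else xi j 0).
have -> : corner x xi n + b *: delta_mx i 0 = corner x xi' i.+1.
  rewrite cornerS !mxE eqxx; congr (_ + _); rewrite /corner; congr (_ + _).
  apply/colP => j; rewrite !mxE; case: ifP => // ji.
  by rewrite -val_eqE ltn_eqF.
have ddi : forall (j : 'I_d) y, (j < i.+1)%N -> derivable D y (delta_mx j 0).
  by move=> j y ji; apply: ddF.
have := corner_increment_le D x xi' i.+1 B nd ddi (fun j y ji => DB j i y ji).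
move/le_trans; apply; rewrite ler_wpM2l//.
apply: le_trans (sum_norm_ord_le _ _) _; apply: ler_sum => j _.
by rewrite mxE; case: eqP => // ->.
Qed.

End coordinatewise_taylor.

(** * Mixed derivatives and their suprema *)

Section words.
Context {d : nat}.
Implicit Types (i j : 'I_d) (p : nat) (b : 'I_d -> nat).

Lemma size_mixed_word p b : size (mixed_word p b) = (p + \sum_(i < d) b i)%N.
Proof.
rewrite /mixed_word size_cat size_nseq; congr addn.
rewrite size_flatten /shape -map_comp sumnE big_map big_enum /=.
by apply: eq_bigr => i _; rewrite size_nseq.
Qed.

Lemma mixed_word0 p b : (\sum_(i < d) b i)%N = 0 ->
  mixed_word p b = nseq p None.
Proof.
move=> b0; have := size_mixed_word p b; rewrite b0 addn0 /mixed_word.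
rewrite size_cat size_nseq -[RHS]addn0 => /addnI /size0nil ->.
by rewrite cats0.
Qed.

Let flatten_notin (b : 'I_d -> nat) (s : seq 'I_d) :
  {in s, forall k, b k = 0} ->
  flatten [seq nseq (b k) (Some k) | k <- s] = [::].
Proof.
elim: s => //= k s IH bs; rewrite bs ?mem_head//= IH// => l ls.
by rewrite bs// in_cons ls orbT.
Qed.

Let flatten_single i (b : 'I_d -> nat) (s : seq 'I_d) : uniq s -> i \in s ->
  {in s, forall k, b k = (k == i)} ->
  flatten [seq nseq (b k) (Some k) | k <- s] = [:: Some i].
Proof.
elim: s => //= k s IH /andP[ks us]; rewrite in_cons => /orP[/eqP ik|si] bs.
  subst k; rewrite bs ?mem_head// eqxx flatten_notin// => l ls.
  by rewrite bs ?in_cons ?ls ?orbT//; case: eqP => // lk; rewrite -lk ls in ks.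
rewrite bs ?mem_head// (_ : k == i = false) /=.
  by apply: IH => // l ls; rewrite bs// in_cons ls orbT.
by apply/eqP => ki; rewrite ki si in ks.
Qed.

Lemma mixed_word1 i : mixed_word 0 (fun k => k == i) = [:: Some i].
Proof. by rewrite /mixed_word (flatten_single i) ?enum_uniq ?mem_enum. Qed.

Lemma mixed_word2 i j : (j <= i)%N ->
  mixed_word 0 (fun k => ((k == j) + (k == i))%N) = [:: Some j; Some i].
Proof.
move=> ji; rewrite /mixed_word /=.
pose b k := ((k == j) + (k == i))%N.
suff H (s : seq 'I_d) : uniq s -> sorted ltn (map val s) -> i \in s ->
  j \in s ->
    flatten [seq nseq (b k) (Some k) | k <- s] = [:: Some j; Some i].
  by apply: H; rewrite ?enum_uniq ?mem_enum// val_enum_ord iota_ltn_sorted.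
elim: s => //= k s IH /andP[ks us] srt si sj.
have [kj|kj] := eqVneq k j.
  rewrite {1}/b -kj eqxx /=; have [ki|ki] := eqVneq k i.
    rewrite flatten_notin -?ki// => l ls; rewrite /b -kj -ki.
    by case: eqP => // lk; rewrite -lk ls in ks.
  rewrite /= (flatten_single i)//.
    by move: si; rewrite in_cons eq_sym (negbTE ki).
  move=> l ls; rewrite /b -kj; case: eqP => // lk.
  by rewrite -lk ls in ks.
have sj' : j \in s by move: sj; rewrite in_cons eq_sym (negbTE kj).
have kltj : (k < j)%N.
  move: srt; rewrite (path_sortedE ltn_trans) => /andP[/allP + _].
  by apply; apply/mapP; exists j.
have ki : k != i by rewrite -val_eqE ltn_eqF//; exact: leq_trans kltj ji.
rewrite {1}/b (negbTE kj) (negbTE ki) /=; apply: IH => //.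
  exact: path_sorted srt.
by move: si; rewrite in_cons eq_sym (negbTE ki).
Qed.

End words.

Section seminorms.
Context {R : realType} {d : nat}.
Variables (T : R) (v : R -> 'cV[R]_d -> R).

Lemma seminorm_ge0 p q : 0 <= seminorm T p q v.
Proof.
rewrite /seminorm; set A := (X in sup X).
have [[[r Ar] ubA]|/sup_out ->//] := pselect (has_sup A).
apply: le_trans (ub_le_sup ubA Ar).
by case: Ar => t [x [b [_ _ ->]]].
Qed.

(** The supremum is taken over a bounded set, so it is a genuine bound. *)
Lemma le_seminorm k p q (b : 'I_d -> nat) t x : Cb T k v -> (p + q <= k)%N ->
  (\sum_(i < d) b i)%N = q -> t \in `[0, T] ->
  `|pderivs T (mixed_word p b) v t x| <= seminorm T p q v.
Proof.
move=> [_ Cv] pqk bq tT; apply: ub_le_sup; last by exists t, x, b.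
(* a bound common to all [b]: there are finitely many words of length
   [p + q], each of them with its own bound *)
pose B (s : (p + q).-tuple (option 'I_d)) := xget 0
  [set B | forall t x, t \in `[0, T] -> `|pderivs T s v t x| <= B].
have BP (s : (p + q).-tuple (option 'I_d)) t' x' :
  t' \in `[0, T] -> `|pderivs T s v t' x'| <= B s.
  have [|_ Bs] := Cv s; first by rewrite size_tuple.
  by move=> /(xgetPex (0 : R) Bs).
exists (\sum_s `|B s|) => _ [t' [x' [b' [tT' b'q ->]]]].
have sz : size (mixed_word p b') == (p + q)%N by rewrite size_mixed_word b'q.
apply: le_trans (BP (Tuple sz) t' x' tT') _.
by rewrite (bigD1 (Tuple sz))//= (le_trans (ler_norm _))// lerDl sumr_ge0.
Qed.

End seminorms.

(** * Increments of functions of class C^2_b *)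

Section Cb_functions.
Context {R : realType} {d : nat}.
Variables (T : R) (v : R -> 'cV[R]_d -> R).
Hypothesis Cv : Cb T 2 v.

Lemma Cb_continuous_space (t : R) : t \in `[0, T] -> continuous (v t).
Proof.
move=> tT x; have [_ H] := Cv; have [|cv _] := H [::]; first by [].
have {cv} := proj1 (subspace_continuousP _ _) cv (t, x).
move=> /(_ (conj tT I)) /= cv.
move=> P /cv; rewrite /within /= => nP.
have ct : {for x, continuous (fun y : 'cV[R]_d => (t, y))}.
  by apply: (@cvg_pair _ _ _ (nbhs x) (nbhs t) (nbhs x) _ _ _ (fun=> t) id);
    [exact: cvg_cst|exact: cvg_id].
apply: (@filterS _ (nbhs x) (nbhs_filter x) _ _ _ (ct _ nP)) => y /= Py.
by apply: Py; split.
Qed.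

Lemma Cb_continuous_time (x : 'cV[R]_d) :
  {within `[0, T], continuous (fun t => v t x)}.
Proof.
have [_ H] := Cv; have [|cv _] := H [::]; first by [].
apply/subspace_continuousP => t tT.
have {cv} := proj1 (subspace_continuousP _ _) cv (t, x).
move=> /(_ (conj tT I)) /= cv.
move=> P /cv; rewrite /within /= => nP.
have ct : {for t, continuous (fun s : R => (s, x))}.
  by apply: (@cvg_pair _ _ _ (nbhs t) (nbhs t) (nbhs x) _ _ _ id (fun=> x));
    [exact: cvg_id|exact: cvg_cst].
apply: (@filterS _ (nbhs t) (nbhs_filter t) _ _ _ (ct _ nP)) => s /= Ps sT.
by apply: Ps; split.
Qed.

(** In the interior of [[0, T]] the derivative relative to that interval is the
    usual two-sided one. *)
Lemma Cb_is_derive_time (x : 'cV[R]_d) (t : R) : t \in `]0, T[ ->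
  is_derive t 1 (fun s => v s x) (pderiv T None v t x).
Proof.
move=> tT; have tT' : t \in `[0, T] by exact: subset_itv_oo_cc.
have [H _] := Cv; have /= := H None [::] erefl t x tT'.
rewrite /pderiv /=; set l := lim _ => cl; have {cl} cl : _ --> l := cl.
have c1 : h^-1 *: (v (h *: (1 : R) + t) x - v t x) @[h --> 0^'] --> l.
  apply: cvg_trans cl.
  rewrite (_ : (fun h : R => _) = time_quotient v t x \o (fun h => h + t)).
    suff shift_near (P : set R) : within `[0, T] t^' P ->
        0^' (fun h : R => P (h + t)) by move=> P; exact: shift_near.
    move=> Pt.
    have nP : nbhs t [set u | u != t -> u \in `[0, T] -> P u] by [].
    change (nbhs (0 : R) [set h : R | h != 0 -> P (h + t)]).
    have c0 : (h + t) @[h --> (0 : R)] --> t.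
      by rewrite -[X in _ --> X]add0r; apply: cvgD;
        [exact: cvg_id|exact: cvg_cst].
    have nT : nbhs t [set u | u \in `[0, T]].
      by apply: filterS (near_in_itvoo tT) => u; exact: subset_itv_oo_cc.
    apply: (@filterS _ (nbhs (0 : R)) (nbhs_filter (0 : R)) _ _ _
      (c0 _ (filterI nP nT))) => h /= [Ph hT] h0.
    by apply: Ph => //; rewrite -subr_eq0 addrK.
  by apply/funext => h /=; rewrite /time_quotient addrK [h *: 1]mulr1.
split; first by apply/cvg_ex; exists l.
exact/cvg_lim.
Qed.

Lemma Cb_time_increment_le (t h : R) x : 0 <= t -> 0 <= h -> t + h <= T ->
  `|v (t + h) x - v t x| <= h * seminorm T 1 0 v.
Proof.
move=> t0 h0 thT; have tth : t <= t + h by rewrite lerDl.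
have dv s : s \in `]t, (t + h)[ ->
  is_derive s 1 (fun s => v s x) (pderiv T None v s x).
  rewrite in_itv /= => /andP[ts sth]; apply: Cb_is_derive_time.
  by rewrite in_itv /= (le_lt_trans t0 ts) (lt_le_trans sth thT).
have cv : {within `[t, (t + h)], continuous (fun s => v s x)}.
  apply: continuous_subspaceW (Cb_continuous_time x) => s /=.
  by rewrite !in_itv /= => /andP[ts sth];
    rewrite (le_trans t0 ts) (le_trans sth thT).
have [s] := MVT_segment tth dv cv; rewrite in_itv /= => /andP[ts sth] ->.
rewrite addrAC subrr add0r normrM (ger0_norm h0) mulrC ler_wpM2l//.
have b0 : (\sum_(i < d) (fun=> 0%N) i)%N = 0 by rewrite big1.
have sT : s \in `[0, T] by rewrite in_itv /= (le_trans t0 ts)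
  (le_trans sth thT).
by have := le_seminorm T v 2 1 0 (fun=> 0%N) s x Cv erefl b0 sT;
  rewrite mixed_word0.
Qed.

Lemma grad_le (t : R) (x : 'cV[R]_d) i : t \in `[0, T] ->
  `|grad T v t x i 0| <= seminorm T 0 1 v.
Proof.
move=> tT; rewrite mxE.
have b1 : (\sum_(k < d) (fun k => (k == i) : nat) k)%N = 1%N.
  by rewrite (bigD1 i)//= eqxx big1// => j /negbTE ->.
by have := le_seminorm T v 2 0 1 _ t x Cv erefl b1 tT; rewrite mixed_word1.
Qed.

Lemma Cb_taylor2 (t : R) x (xi : 'cV[R]_d) : t \in `[0, T] ->
  `|v t (x + xi) - v t x - \sum_(i < d) xi i 0 * grad T v t x i 0|
  <= seminorm T 0 2 v * (\sum_(i < d) `|xi i 0|) ^+ 2.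
Proof.
move=> tT; have [H _] := Cv.
under eq_bigr do rewrite mxE.
apply: coordinatewise_taylor2.
- exact: seminorm_ge0.
- by move=> i y; exact: (H (Some i) [::] erefl t y tT).
- by move=> j i y ji; exact: (H (Some j) [:: Some i] erefl t y tT).
- move=> j i y ji.
  have b2 : (\sum_(k < d) (fun k => (k == j) + (k == i)) k)%N = 2%N.
    rewrite big_split /= (bigD1 j)//= eqxx big1 => [|k /negbTE ->//].
    by rewrite (bigD1 i)//= eqxx big1// => k /negbTE ->.
  by have := le_seminorm T v 2 0 2 _ t y Cv erefl b2 tT; rewrite mixed_word2.
Qed.

End Cb_functions.

(** * Borel sets of matrices *)

Section borel_matrices.
Context {R : realType} {m n : nat}.

Lemma open_measurable_mx (U : set 'M[R]_(m, n)) : open U -> measurable U.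
Proof. by move=> oU; apply: sub_sigma_algebra. Qed.

Lemma continuous_measurable_mx (F : 'M[R]_(m, n) -> R) :
  continuous F -> measurable_fun [set: 'M[R]_(m, n)] F.
Proof.
move=> cF; apply: (measurability _ (RGenOpens.measurableE R)).
move=> _ [_ [a [b ->]] <-]; rewrite setTI; apply: open_measurable_mx.
by move/continuousP : cF; apply; exact: interval_open.
Qed.

Lemma measurable_mx_coord i j :
  measurable_fun [set: 'M[R]_(m, n)] (fun A : 'M[R]_(m, n) => A i j).
Proof. by apply: continuous_measurable_mx => A; exact: coord_continuous. Qed.

(** Open sets of matrices are countable unions of boxes with rational centres
    and radii [k.+1^-1], so the Borel structure is generated by the entries. *)
Lemma measurable_fun_mx {disp} {S : measurableType disp}
    (Z : S -> 'M[R]_(m, n)) :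
  (forall i j, measurable_fun setT (fun w => Z w i j)) -> measurable_fun setT Z.
Proof.
move=> mZ; apply: (measurability [set U : set 'M[R]_(m, n) | open U]) => //.
move=> _ [U oU <-]; rewrite setTI.
pose box (p : 'M[rat]_(m, n) * nat) : set 'M[R]_(m, n) :=
  [set A | forall i j, `|A i j - ratr (p.1 i j)| < p.2.+1%:R^-1].
have -> : Z @^-1` U = \bigcup_p
  (if `[< box p `<=` U >] then Z @^-1` box p else set0).
  apply/seteqP; split=> [w /= Uw|w [p _]]; last first.
    by case: ifPn => // /asboolP + bw; apply.
  have /nbhs_ballP[e /= e0 eU] : nbhs (Z w) U by exact: open_nbhs_nbhs.
  have e20 : 0 < e / 2 by rewrite divr_gt0.
  have [k ke] : exists k : nat, k.+1%:R^-1 < e / 2.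
    have [k _ /(_ k (leqnn k)) H] := near_infty_natSinv_lt (PosNum e20).
    by exists k.
  have qP i j : exists q : rat, `|Z w i j - ratr q| < k.+1%:R^-1.
    have /rat_in_itvoo[q] : Z w i j - k.+1%:R^-1 < Z w i j + k.+1%:R^-1.
      by rewrite ltrBlDr -addrA ltrDl addr_gt0// invr_gt0.
    by rewrite in_itv /= => /andP[q1 q2]; exists q;
      rewrite distrC ltr_distl q1 q2.
  pose q := \matrix_(i, j) (projT1 (cid (qP i j))).
  exists (q, k) => //; rewrite ifT.
    by move=> i j; rewrite mxE; exact: (projT2 (cid (qP i j))).
  apply/asboolP => A bA; apply: eU; split=> // i j.
  have := bA i j; have := projT2 (cid (qP i j)); rewrite /= mxE /ball /=.
  set x := ratr _ => h1 h2.
  rewrite (_ : Z w i j - A i j = (Z w i j - x) - (A i j - x)); last by ring.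
  apply: le_lt_trans (ler_normB _ _) _; rewrite [e]splitr.
  by apply: ltrD; [exact: lt_trans h1 ke|exact: lt_trans h2 ke].
apply: countable_bigcupT_measurable => [|p]; first exact: countableP.
case: ifP => // _.
rewrite (_ : _ @^-1` _ = \bigcap_(ij in [set: 'I_m * 'I_n])
   ((fun w => `|Z w ij.1 ij.2 - ratr (p.1 ij.1 ij.2)|) @^-1` `]-oo,
     p.2.+1%:R^-1[)); last first.
  apply/seteqP; split=> [w bw [i j] _|w bw i j] /=.
    by rewrite in_itv /=; exact: bw.
  by have := bw (i, j) I; rewrite /= in_itv.
apply: fin_bigcap_measurable => // -[i j] _ /=.
rewrite -[X in measurable X]setTI.
suff H : measurable_fun setT (fun w => `|Z w i j - ratr (p.1 i j)|) by exact: H.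
by apply: measurableT_comp => //; apply: measurable_funB.
Qed.

End borel_matrices.

(** * Moments of the centred normal law *)

Section gaussian_moments.
Context {R : realType}.
Notation mu := (@lebesgue_measure R).
Variable s : R.
Hypothesis s0 : 0 < s.
Implicit Types (r x : R) (f : R -> R).

Let sN0 : s != 0. Proof. by rewrite gt_eqF. Qed.

Lemma ge0_integral_normal_prob f : measurable_fun setT f ->
  (forall x, 0 <= f x) ->
  (\int[normal_prob 0 s]_x (f x)%:E = \int[mu]_x (f x * normal_pdf 0 s x)%:E)%E.
Proof.
move=> mf f0; have dom := normal_prob_dominates 0 s.
pose g := Radon_Nikodym_SigmaFinite.f (normal_prob 0 s) mu.
rewrite -(Radon_Nikodym_SigmaFinite.change_of_variables dom)//;
  last exact/measurable_EFinP.
under [RHS]eq_integral do rewrite EFinM.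
apply: ae_eq_integral => //.
- apply: emeasurable_funM; first exact/measurable_EFinP.
  exact: measurable_int (Radon_Nikodym_SigmaFinite.f_integrable dom).
- apply: emeasurable_funM; first exact/measurable_EFinP.
  by apply/measurable_EFinP; exact: measurable_normal_pdf.
- apply: ae_eqe_mul2l; apply: integral_ae_eq => //.
  + exact: Radon_Nikodym_SigmaFinite.f_integrable.
  + by apply/measurable_EFinP; exact: measurable_normal_pdf.
  + by move=> A _ mA; rewrite -Radon_Nikodym_SigmaFinite.f_integral.
Qed.

(** Weighting the density by [expR (c * x ^+ 2)] only rescales the standard
    deviation, so all these exponential moments come from total masses. *)
Lemma normal_pdf_rescale r x : 0 < r ->
  expR ((x / s) ^+ 2 / 2 * (1 - r ^- 2)) * normal_pdf 0 s x =
  r * normal_pdf 0 (r * s) x.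
Proof.
move=> r0; have rN0 : r != 0 by rewrite gt_eqF.
have peakM : normal_peak (r * s) = r^-1 * normal_peak s.
  rewrite /normal_peak exprMn -mulrA -mulrnAr sqrtrM ?sqr_ge0// sqrtr_sqr.
  by rewrite gtr0_norm// invfM.
rewrite !normal_pdfE ?mulf_neq0// /normal_fun subr0 peakM.
rewrite [LHS]mulrCA.
have -> : r * (r^-1 * normal_peak s * expR (- x ^+ 2 / ((r * s) ^+ 2 *+ 2))) =
    normal_peak s * expR (- x ^+ 2 / ((r * s) ^+ 2 *+ 2)).
  by rewrite !mulrA divff// mul1r.
rewrite -expRD; congr (_ * expR _);
  rewrite -[s ^+ 2 *+ 2]mulr_natr -[(r * s) ^+ 2 *+ 2]mulr_natr; field.
by rewrite rN0 sN0.
Qed.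

Lemma integral_normal_rescale r : 0 < r ->
  (\int[mu]_x (r * normal_pdf 0 (r * s) x)%:E = r%:E)%E.
Proof.
move=> r0; under eq_integral do rewrite EFinM.
by rewrite integralZl ?integrable_normal_pdf// integral_normal_pdf mule1.
Qed.

Let q x := (x / s) ^+ 2.

Let measurable_q : measurable_fun setT q.
Proof. by apply: measurable_funX; apply: measurable_funM. Qed.

(** The density of standard deviation [sqrt 2 * s] absorbs any power of [x]; the
    constant comes from [(x / s) ^+ 4 <= 64 * expR (x ^+ 2 / (4 * s ^+ 2))]. *)
Lemma normal_fourth_moment :
  (\int[normal_prob 0 s]_x ((x / s) ^+ 4)%:E <= (64 * Num.sqrt 2)%:E)%E.
Proof.
rewrite ge0_integral_normal_prob; last 2 first.
- by apply: measurable_funX; apply: measurable_funM.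
- by move=> x; rewrite exprn_even_ge0.
have r0 : 0 < Num.sqrt 2 :> R by rewrite sqrtr_gt0.
rewrite EFinM -[X in (_ * X)%E](integral_normal_rescale _ r0).
rewrite -ge0_integralZl//; last 2 first.
- apply/measurable_EFinP; apply: measurable_funM => //.
  exact: measurable_normal_pdf.
- by move=> x _; rewrite lee_fin mulr_ge0 ?normal_pdf_ge0// ltW.
apply: ge0_le_integral => //.
- by move=> x _; rewrite lee_fin mulr_ge0 ?normal_pdf_ge0 ?exprn_even_ge0.
- apply/measurable_EFinP; apply: measurable_funM;
  last exact: measurable_normal_pdf.
  by apply: measurable_funX; apply: measurable_funM.
- apply/measurable_EFinP; apply: measurable_funM => //.
  by apply: measurable_funM => //; exact: measurable_normal_pdf.
move=> x _; rewrite lee_fin -normal_pdf_rescale// mulrA.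
rewrite ler_wpM2r ?normal_pdf_ge0// sqr_sqrtr//.
have -> : (x / s) ^+ 2 / 2 * (1 - 2^-1) = q x / 8 + q x / 8.
  by rewrite /q; field; rewrite sN0.
have q0 : 0 <= q x by exact: sqr_ge0.
have q80 : 0 <= q x / 8 by rewrite divr_ge0.
(* [expR (2 * y) = expR y ^+ 2 >= y ^+ 2] at [y = q x / 8] *)
have h := expR_ge1Dx (q x / 8).
have -> : (x / s) ^+ 4 = q x ^+ 2 by rewrite /q -exprM.
rewrite expRD; nra.
Qed.

Let integrable_q : mu.-integrable setT (fun x => (q x * normal_pdf 0 s x)%:E).
Proof.
apply/integrableP; split.
  apply/measurable_EFinP; apply: measurable_funM => //.
  exact: measurable_normal_pdf.
pose r : R := Num.sqrt 2; have r0 : 0 < r by rewrite sqrtr_gt0.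
apply: (@le_lt_trans _ _ (4%:E *
  (\int[mu]_x (r * normal_pdf 0 (r * s) x)%:E))%E); last first.
  by rewrite integral_normal_rescale// -EFinM ltry.
rewrite -ge0_integralZl//; last 2 first.
- apply/measurable_EFinP; apply: measurable_funM => //.
  exact: measurable_normal_pdf.
- by move=> x _; rewrite lee_fin mulr_ge0 ?normal_pdf_ge0// ltW.
apply: ge0_le_integral => //.
- apply/measurable_EFinP; apply: measurableT_comp => //;
  apply: measurable_funM => //.
  exact: measurable_normal_pdf.
- apply/measurable_EFinP; apply: measurable_funM => //.
  by apply: measurable_funM => //; exact: measurable_normal_pdf.
move=> x _; rewrite /= lee_fin -normal_pdf_rescale// mulrA normrM.
have q0 : 0 <= q x by exact: sqr_ge0.
rewrite !ger0_norm ?normal_pdf_ge0// ler_wpM2r ?normal_pdf_ge0// sqr_sqrtr//.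
have -> : (x / s) ^+ 2 / 2 * (1 - 2^-1) = q x / 4 by rewrite /q; field;
  rewrite sN0.
have h := expR_ge1Dx (q x / 4); lra.
Qed.

(** Integrating [1 + y <= expR y], for [y] a multiple of [(x / s) ^+ 2], gives
    by rescaling [1 + (1 - r ^- 2) / 2 * m <= r] for the moment [m] and every
    [r > 0]; both sides agree at [r = 1], so letting [r] tend to 1 from above
    and from below squeezes [m]. *)
Lemma normal_second_moment : (\int[normal_prob 0 s]_x ((x / s) ^+ 2)%:E = 1)%E.
Proof.
rewrite ge0_integral_normal_prob//; last by move=> x; exact: sqr_ge0.
rewrite -/(q _); set I := integral _ _ _.
have Ifin : I \is a fin_num by exact: integrable_fin_num integrable_q.
pose m := fine I; have IE : I = m%:E by rewrite fineK.
have m0 : 0 <= m.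
  by apply: fine_ge0; apply: integral_ge0 => x _;
    rewrite lee_fin mulr_ge0 ?sqr_ge0 ?normal_pdf_ge0.
have key r : 0 < r -> 2 * r ^+ 2 + (r ^+ 2 - 1) * m <= 2 * r ^+ 3.
  move=> r0; pose c := (1 - r ^- 2) / 2.
  suff H : 1 + c * m <= r.
    rewrite /c in H.
    have : 2 * r ^+ 2 * (1 + (1 - r ^- 2) / 2 * m) <= 2 * r ^+ 2 * r.
      by rewrite ler_wpM2l// mulr_ge0// sqr_ge0.
    have -> : 2 * r ^+ 2 * (1 + (1 - r ^- 2) / 2 * m) =
      2 * r ^+ 2 + (r ^+ 2 - 1) * m.
      by field; rewrite gt_eqF.
    by rewrite -mulrA -exprSr.
  rewrite -lee_fin EFinD EFinM -IE -(integral_normal_pdf 0 s)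
    -(integral_normal_rescale r)//.
  rewrite /I -integralZl// -integralD//; last 2 first.
  - exact: integrable_normal_pdf.
  - exact: integrableZl.
  apply: le_integral => //.
  - by apply: integrableD => //;
    [exact: integrable_normal_pdf|exact: integrableZl].
  - rewrite (_ : (fun x => _) = (fun x => r%:E *
    (normal_pdf 0 (r * s) x)%:E)%E).
      by apply: integrableZl => //; exact: integrable_normal_pdf.
    by apply/funext => x; rewrite EFinM.
  move=> x _; rewrite -EFinM -EFinD lee_fin -normal_pdf_rescale// mulrA.
  rewrite -[X in X + _]mul1r -mulrDl ler_wpM2r ?normal_pdf_ge0//.
  apply: le_trans (expR_ge1Dx _); rewrite /c /q lerD2l le_eqVlt; apply/orP;
    left.
  by apply/eqP; ring.
rewrite IE; congr EFin; apply/eqP; rewrite eq_le; apply/andP; split.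
- apply/ler_addgt0Pr => e e0; pose a := Num.min (e / 3) 1.
  have a0 : 0 < a by rewrite /a lt_min divr_gt0//= ltr01.
  have a1 : a <= 1 by rewrite /a ge_min lexx orbT.
  have ae : a <= e / 3 by rewrite /a ge_min lexx.
  have K := key (1 + a) (addr_gt0 ltr01 a0).
  have : a * ((2 + a) * m - 2 * (1 + a) ^+ 2) <= 0.
    by rewrite [leLHS](_ : _ = ((1 + a) ^+ 2 - 1) * m -
      (2 * (1 + a) ^+ 3 - 2 * (1 + a) ^+ 2)); [lra|ring].
  rewrite pmulr_rle0// => h.
  have am : 0 <= a * m by rewrite mulr_ge0// ltW.
  have aa : a * a <= a by rewrite ler_piMr// ltW.
  move: h; rewrite expr2 => h; nra.
- apply/ler_addgt0Pr => e e0; pose a := Num.min (e / 2) (2^-1).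
  have a0 : 0 < a by rewrite /a lt_min divr_gt0//= invr_gt0.
  have a1 : a <= 2^-1 by rewrite /a ge_min lexx orbT.
  have ae : a <= e / 2 by rewrite /a ge_min lexx.
  have ra : 0 < 1 - a by lra.
  have K := key (1 - a) ra.
  have : a * (2 * (1 - a) ^+ 2 - (2 - a) * m) <= 0.
    by rewrite [leLHS](_ : _ = ((1 - a) ^+ 2 - 1) * m -
      (2 * (1 - a) ^+ 3 - 2 * (1 - a) ^+ 2)); [lra|ring].
  rewrite pmulr_rle0// => h.
  have am : 0 <= a * m by rewrite mulr_ge0// ltW.
  have aa : 0 <= a * a by rewrite mulr_ge0// ltW.
  move: h; rewrite expr2 => h; nra.
Qed.

End gaussian_moments.

Section gaussian_symmetry.
Context {R : realType}.
Variable s : R.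
Hypothesis s0 : 0 < s.

Lemma normal_prob_even_half (f : R -> R) : continuous f ->
  (forall x, 0 <= f x) -> (forall x, f (- x) = f x) ->
  (\int[normal_prob 0 s]_x (f x)%:E =
   2%:E * \int[normal_prob 0 s]_x (f x * (0 <= x)%R%:R)%:E)%E.
Proof.
move=> cf f0 fe; have sN0 : s != 0 by rewrite gt_eqF.
have mf : measurable_fun setT f by exact: continuous_measurable_fun.
have mI : measurable_fun setT (fun x : R => (0 <= x)%R%:R : R).
  rewrite (_ : (fun x : R => _) = \1_`[0, +oo[); first exact: measurable_indic.
  by apply/funext => x; rewrite indicE mem_setE /= in_itv /= andbT.
rewrite !ge0_integral_normal_prob//; last 2 first.
- exact: measurable_funM.
- by move=> x; rewrite mulr_ge0.
rewrite ge0_symfun_integralT; last 3 first.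
- by move=> x; rewrite mulr_ge0// normal_pdf_ge0.
- by move=> x; apply: cvgM; [exact: cf|exact: continuous_normal_pdf].
- by move=> x /=; rewrite fe !normal_pdfE// /normal_fun !subr0 sqrrN.
congr (_ * _)%E; rewrite integral_mkcond; apply: eq_integral => x _.
rewrite patchE; case: ifPn => [/set_mem /= ->|/negP x0]; first by rewrite mulr1.
have [h|_] := boolP (0 <= x); first by exfalso; apply: x0; exact/mem_set.
by rewrite mulr0 mul0r.
Qed.

End gaussian_symmetry.

(** * Independent pairs *)

Section independence.
Context {R : realType} {disp d1 d2 : measure_display}.
Context {Omega : measurableType disp} (P : probability Omega R).
Context {T1 : measurableType d1} {T2 : measurableType d2}.
Variables (X : Omega -> T1) (Y : Omega -> T2).
Hypotheses (mX : measurable_fun setT X) (mY : measurable_fun setT Y).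
Hypothesis XY_indep : forall A B, measurable A -> measurable B ->
  (P (X @^-1` A `&` Y @^-1` B) = P (X @^-1` A) * P (Y @^-1` B))%E.

Let X' : {mfun Omega >-> T1} := HB.pack X (isMeasurableFun.Build _ _ _ _ X mX).
Let Y' : {mfun Omega >-> T2} := HB.pack Y (isMeasurableFun.Build _ _ _ _ Y mY).
Let mXY : measurable_fun setT (fun w => (X w, Y w)).
Proof. exact: measurable_fun_pair. Qed.
Let Z' : {mfun Omega >-> (T1 * T2)%type} :=
  HB.pack (fun w => (X w, Y w)) (isMeasurableFun.Build _ _ _ _ _ mXY).

(* the law of the pair is determined by its values on rectangles *)
Let joint_law A : measurable A ->
  (distribution P X' \x distribution P Y')%E A = distribution P Z' A.
Proof.
move=> mA; exact: (@product_measure_unique _ _ _ _ _ (distribution P X')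
  (distribution P Y')
  (distribution P Z') XY_indep A mA).
Qed.

Variable phi : T1 * T2 -> R.
Hypothesis mphi : measurable_fun setT phi.
Hypothesis iphi : P.-integrable setT (fun w => (phi (X w, Y w))%:E).
Hypothesis iphi2 : forall x, P.-integrable setT (fun w => (phi (x, Y w))%:E).

Let m x : R := \int[P]_w phi (x, Y w).

Let iphi_prod : (distribution P X' \x distribution P Y')%E.-integrable setT
  (EFin \o phi).
Proof.
apply/integrableP; split; first exact/measurable_EFinP.
rewrite (eq_measure_integral (distribution P Z')); last by move=> A mA _;
  exact: joint_law.
rewrite ge0_integral_pushforward//; last first.
  by apply: measurableT_comp => //; exact/measurable_EFinP.
by have /integrableP[] := iphi.
Qed.

Let fubini_FE : fubini_F (distribution P Y') (EFin \o phi) = EFin \o m.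
Proof.
apply/funext => x; rewrite /fubini_F /= /m /Rintegral fineK; last first.
  exact: integrable_fin_num (iphi2 x).
rewrite integral_pushforward//.
- by apply/measurable_EFinP; exact: measurableT_comp.
- exact: iphi2.
Qed.

Lemma indep_measurable_section : measurable_fun setT m.
Proof.
by apply/measurable_EFinP; rewrite -fubini_FE;
  exact: measurable_fubini_F iphi_prod.
Qed.

Lemma indep_integrable_section : P.-integrable setT (EFin \o (m \o X)).
Proof.
have := integrable_fubini_F iphi_prod; rewrite fubini_FE => /integrableP[mm im].
apply/integrableP; split.
  by apply/measurable_EFinP; apply: measurableT_comp => //;
    exact: indep_measurable_section.
rewrite ge0_integral_pushforward// in im.
by apply: measurableT_comp => //; exact: indep_measurable_section.
Qed.

(** The law of an independent pair is a product measure, so Fubini lets the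
    second variable be averaged out with the first one frozen. *)
Lemma indep_integral :
  (\int[P]_w (phi (X w, Y w))%:E = \int[P]_w (m (X w))%:E)%E.
Proof.
have mE : measurable_fun setT (EFin \o phi) by exact/measurable_EFinP.
transitivity (\int[distribution P Z']_z (EFin \o phi) z)%E.
  by rewrite integral_pushforward.
rewrite (eq_measure_integral (distribution P X' \x distribution P Y')%E);
  last first.
  by move=> A mA _; apply/esym; exact: joint_law.
rewrite -integral12_prod_meas1// fubini_FE integral_pushforward//.
- by apply/measurable_EFinP; exact: indep_measurable_section.
- exact: indep_integrable_section.
Qed.

End independence.

(** * Normal random variables and vectors *)

Section normal_random_variable.
Context {R : realType} {disp : measure_display} {Omega : measurableType disp}.
Variables (P : probability Omega R) (s : R) (X : Omega -> R).
Hypotheses (s0 : 0 < s) (mX : measurable_fun setT X).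
Hypothesis lawX : forall B, measurable B -> P (X @^-1` B) = normal_prob 0 s B.

Let X' : {mfun Omega >-> measurableTypeR R} :=
  HB.pack X (isMeasurableFun.Build _ _ Omega (measurableTypeR R) X mX).

Let ge0_expectation (f : R -> R) :
  measurable_fun setT f -> (forall x, 0 <= f x) ->
  (\int[P]_w (f (X w))%:E = \int[normal_prob 0 s]_x (f x)%:E)%E.
Proof.
move=> mf f0; have mfE : measurable_fun setT (EFin \o f) by
  exact/measurable_EFinP.
transitivity (\int[distribution P X']_x (f x)%:E)%E.
  by rewrite ge0_integral_pushforward//= => x _; rewrite lee_fin.
apply: eq_measure_integral => A mA _; exact: lawX.
Qed.

Lemma normal_rv_fourth_moment :
  (\int[P]_w ((X w / s) ^+ 4)%:E <= (64 * Num.sqrt 2)%:E)%E.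
Proof.
rewrite (ge0_expectation (fun x => (x / s) ^+ 4)).
- exact: normal_fourth_moment.
- by apply: measurable_funX; apply: measurable_funM.
- by move=> x; rewrite exprn_even_ge0.
Qed.

Let mX4 : measurable_fun setT (fun w => (X w / s) ^+ 4).
Proof. by apply: measurable_funX; apply: measurable_funM. Qed.

Lemma normal_rv_integrable4 : P.-integrable setT (fun w => ((X w / s) ^+ 4)%:E).
Proof.
apply/integrableP; split; first exact/measurable_EFinP.
under eq_integral do rewrite /= ger0_norm ?exprn_even_ge0//.
exact: le_lt_trans normal_rv_fourth_moment (ltry _).
Qed.

Lemma normal_rv_integrable (f : R -> R) (c : R) : measurable_fun setT f ->
  (forall x, `|f x| <= c * (1 + (x / s) ^+ 4)) ->
  P.-integrable setT (fun w => (f (X w))%:E).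
Proof.
move=> mf fc.
apply: (@le_integrable _ _ _ _ _ _ _ (fun w => (c * (1 + (X w / s) ^+ 4))%:E))
  => //.
- by apply/measurable_EFinP; exact: measurableT_comp.
- by move=> w _; rewrite /= lee_fin (le_trans (fc _))// ler_norm.
rewrite (_ : (fun w => _) = (fun w => c%:E * (1%:E + ((X w / s) ^+ 4)%:E))%E);
  last first.
  by apply/funext => w; rewrite -EFinD -EFinM.
apply: integrableZl => //; apply: integrableD => //.
- exact: finite_measure_integrable_cst.
- exact: normal_rv_integrable4.
Qed.

Let even_half (f : R -> R) : continuous f -> (forall x, 0 <= f x) ->
  (forall x, f (- x) = f x) ->
  P.-integrable setT (fun w => (f (X w))%:E) ->
  \int[P]_w f (X w) = 2 * \int[P]_w (f (X w) * (0 <= X w)%R%:R).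
Proof.
move=> cf f0 fe fi.
have mf : measurable_fun setT f by exact: continuous_measurable_fun.
have mI : measurable_fun setT (fun x : R => (0 <= x)%R%:R : R).
  rewrite (_ : (fun x : R => _) = \1_`[0, +oo[); first exact: measurable_indic.
  by apply/funext => x; rewrite indicE mem_setE in_itv /= andbT.
have mfI : measurable_fun setT (fun x => f x * (0 <= x)%R%:R) by exact:
  measurable_funM.
have E2 := ge0_expectation _ mfI (fun x => mulr_ge0 (f0 x) (ler0n _ _)).
rewrite {1}/Rintegral ge0_expectation// normal_prob_even_half// -E2 fineM//.
apply: integrable_fin_num => //; apply: le_integrable fi => //.
- by apply/measurable_EFinP; exact: (measurableT_comp mfI mX).
- move=> w _; rewrite /= lee_fin normrM ler_piMr// ger0_norm//.
  by case: (0 <= X w).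
Qed.

Let quartic_bounds (x : R) :
  `|x| <= s * (1 + (x / s) ^+ 4) /\ `|x ^+ 2| <= s ^+ 2 * (1 + (x / s) ^+ 4).
Proof.
have [y y0 xy] : exists2 y, 0 <= y & `|x| = s * y.
  by exists (`|x| / s); rewrite ?divr_ge0 ?(ltW s0)// mulrC divfK// gt_eqF.
have -> : (x / s) ^+ 4 = y ^+ 4.
  rewrite expr_div_n -[x ^+ 4]ger0_norm ?exprn_even_ge0// normrX xy exprMn.
  by rewrite mulrC mulrA mulVf ?mul1r// gt_eqF// exprn_gt0.
have y2 : 0 <= (y ^+ 2 - 1) ^+ 2 by exact: sqr_ge0.
have y1 : 0 <= (y - 1) ^+ 2 by exact: sqr_ge0.
have y4 : y ^+ 4 = (y ^+ 2) ^+ 2 by rewrite -exprM.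
rewrite normrX xy exprMn !ler_pM2l ?exprn_gt0// y4.
by split; nra.
Qed.

Lemma normal_rv_integrable1 : P.-integrable setT (fun w => (X w)%:E).
Proof.
by apply: (normal_rv_integrable id s) => // x; exact: (quartic_bounds x).1.
Qed.

Lemma normal_rv_integrable2 : P.-integrable setT (fun w => (X w ^+ 2)%:E).
Proof.
apply: (normal_rv_integrable (fun x => x ^+ 2) (s ^+ 2)) => // x.
exact: (quartic_bounds x).2.
Qed.

Let max_indic (x : R) : Num.max x 0 = `|x| * (0 <= x)%R%:R.
Proof.
by have [x0|x0] := leP 0 x; rewrite ?mulr1 ?mulr0// ger0_norm.
Qed.

(** By symmetry the positive part of [X] carries half of [|X|]; the mean is
    twice the former minus the latter. *)
Lemma normal_rv_mean0 : \int[P]_w X w = 0.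
Proof.
have aX : P.-integrable setT (fun w => (`|X w|)%:E).
  exact: (integrable_norm normal_rv_integrable1).
have E := even_half (fun x => `|x|) (@norm_continuous _ R) (@normr_ge0 _ _)
  (@normrN _ _) aX.
pose X1 w := Num.max (X w) 0.
have iX1 : P.-integrable setT (EFin \o X1).
  apply: le_integrable aX => //.
  - by apply/measurable_EFinP; exact: measurable_maxr.
  - by move=> w _; rewrite /= lee_fin /X1 max_indic normrM ler_piMr//;
    case: (0 <= X w); rewrite ?normr1 ?normr0.
have -> : \int[P]_w X w = \int[P]_w (2 * X1 w - `|X w|).
  apply: eq_Rintegral => w _; rewrite /X1 max_indic.
  by have [x0|x0] := leP 0 (X w); rewrite ?(ger0_norm x0) ?(ltr0_norm x0) /=;
    ring.
rewrite RintegralB//; last first.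
  rewrite (_ : EFin \o _ = (fun w => 2%:E * (X1 w)%:E)%E);
    first exact: integrableZl.
  by apply/funext => w; rewrite /= EFinM.
rewrite RintegralZl// E (_ : (fun w => _) =
  (fun w => `|X w| * (0 <= X w)%R%:R)).
  by rewrite subrr.
by apply/funext => w; exact: max_indic.
Qed.

Lemma normal_rv_square : \int[P]_w (X w ^+ 2) = s ^+ 2.
Proof.
have -> : \int[P]_w (X w ^+ 2) = \int[P]_w (s ^+ 2 * (X w / s) ^+ 2).
  by apply: eq_Rintegral => w _;
    rewrite expr_div_n mulrC divfK// gt_eqF// exprn_gt0.
rewrite /Rintegral; under eq_integral do rewrite EFinM.
rewrite ge0_integralZl//; last 3 first.
- by apply/measurable_EFinP; apply: measurable_funX; apply: measurable_funM.
- by move=> w _; rewrite lee_fin sqr_ge0.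
- by rewrite lee_fin sqr_ge0.
rewrite (ge0_expectation (fun x => (x / s) ^+ 2)).
- by rewrite normal_second_moment// mule1.
- by apply: measurable_funX; apply: measurable_funM.
- by move=> x; exact: sqr_ge0.
Qed.

Lemma normal_rv_positive_half : \int[P]_w (X w * Num.max (X w) 0) = s ^+ 2 / 2.
Proof.
have E := even_half _ (@sqr_continuous R) (@sqr_ge0 R) (@sqrrN R)
  normal_rv_integrable2.
have -> : (fun w => X w * Num.max (X w) 0) =
  (fun w => X w ^+ 2 * (0 <= X w)%R%:R).
  apply/funext => w; rewrite max_indic mulrA; have [x0|x0] := leP 0 (X w);
    last by rewrite !mulr0.
  by rewrite ger0_norm.
by rewrite -normal_rv_square E; field.
Qed.

Lemma normal_rv_negative_half :
  \int[P]_w (X w * - Num.min (X w) 0) = - (s ^+ 2 / 2).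
Proof.
have iXp : P.-integrable setT (fun w => (X w * Num.max (X w) 0)%:E).
  apply: le_integrable normal_rv_integrable2 => //.
    by apply/measurable_EFinP; apply: measurable_funM => //;
      exact: measurable_maxr.
  move=> w _; rewrite /= lee_fin max_indic mulrA normrM.
  have -> : `|X w * `|X w| | = `|X w ^+ 2| by rewrite normrM normr_id -normrM.
  by rewrite ler_piMr//; case: (0 <= X w); rewrite ?normr1 ?normr0.
have -> : (fun w => X w * - Num.min (X w) 0) =
          (fun w => X w * Num.max (X w) 0 - X w ^+ 2).
  by apply/funext => w; have [x0|x0] := leP 0 (X w); ring.
rewrite RintegralB//; last exact: normal_rv_integrable2.
by rewrite normal_rv_positive_half normal_rv_square; field.
Qed.

End normal_random_variable.

Section P1_weight.
Context {R : realType} {d : nat}.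
Implicit Types (g D : 'cV[R]_d).

Lemma P1_scale (h : R) g D : 0 < h -> P1 g (h^-1 *: D) =
  2 / h * \sum_(j < d) (Num.max (g j 0) 0 * Num.max (D j 0) 0 +
                        - Num.min (g j 0) 0 * - Num.min (D j 0) 0).
Proof.
move=> h0; have hV : 0 <= h^-1 by rewrite invr_ge0 ltW.
rewrite /P1 /dotp -big_split /= -mulrA; congr (_ * _); rewrite mulr_sumr.
apply: eq_bigr => j _; rewrite !mxE mulrDr; congr (_ + _).
  by rewrite [RHS]mulrCA (maxr_pMr _ _ hV) mulr0.
by rewrite !mulrNN [RHS]mulrCA (minr_pMr _ _ hV) mulr0.
Qed.

Lemma P1_le (h L : R) g D : 0 < h -> (forall j, `|g j 0| <= L) ->
  `|P1 g (h^-1 *: D)| <= 2 / h * L * \sum_(j < d) `|D j 0|.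
Proof.
move=> h0 gL; rewrite P1_scale// normrM ger0_norm ?divr_ge0// ?(ltW h0)//.
rewrite -mulrA ler_wpM2l ?divr_ge0 ?(ltW h0)//.
apply: le_trans (ler_norm_sum _ _ _) _; rewrite mulr_sumr.
apply: ler_sum => j _; apply: le_trans (ler_wpM2r (normr_ge0 _) (gL j)).
move: (g j 0) (D j 0) => a b.
have [a0|a0] := leP 0 a; have [b0|b0] := leP 0 b;
  rewrite ?mulr0 ?oppr0 ?mul0r ?addr0 ?add0r ?normr0 ?mulr_ge0// ?normrM//.
all: by rewrite ?normrN ?normr0 ?mulr0 ?mulr_ge0.
Qed.

End P1_weight.

Section normal_vector.
Context {R : realType} {d : nat} {disp : measure_display}.
Context {Omega : measurableType disp}.
Variables (P : probability Omega R) (u : R) (D : Omega -> 'cV[R]_d).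
Hypotheses (u0 : 0 < u) (mD : measurable_fun setT D).
Hypothesis lawD : forall B : 'I_d -> set R, (forall i, measurable (B i)) ->
  P [set w | forall i, B i (D w i 0)] = (\prod_(i < d) normal_prob 0 u (B i))%E.

Let mDi i : measurable_fun setT (fun w => D w i 0).
Proof. by apply: (measurableT_comp (measurable_mx_coord i 0) mD). Qed.

Lemma normal_vector_coord i B : measurable B ->
  P ((fun w => D w i 0) @^-1` B) = normal_prob 0 u B.
Proof.
move=> mB; pose C k := if k == i then B else setT.
have mC k : measurable (C k) by rewrite /C; case: eqP.
have := lawD C mC; rewrite (bigD1 i)//= big1 ?mule1; last first.
  by move=> k /negbTE ki; rewrite /C ki; exact: probability_setT.
rewrite {2}/C eqxx => <-; congr (P _); apply/seteqP;
  split=> [w Bw k|w /(_ i)] /=.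
  by rewrite /C; case: eqP => // ->.
by rewrite /C eqxx.
Qed.

Lemma normal_vector_indep i j (A B : set R) : i != j ->
  measurable A -> measurable B ->
  P ((fun w => D w i 0) @^-1` A `&` (fun w => D w j 0) @^-1` B) =
  (P ((fun w => D w i 0%R) @^-1` A) * P ((fun w => D w j 0%R) @^-1` B))%E.
Proof.
move=> ij mA mB; rewrite !normal_vector_coord//.
pose C k := if k == i then A else if k == j then B else setT.
have mC k : measurable (C k) by rewrite /C; case: eqP => // _; case: eqP.
have := lawD C mC; rewrite (bigD1 i)//= (bigD1 j) 1?eq_sym//= big1 ?mule1;
  last first.
  by move=> k /andP[/negbTE ki /negbTE kj]; rewrite /C ki kj;
    exact: probability_setT.
rewrite {2 3}/C eqxx eq_sym (negbTE ij) eqxx => <-; congr (P _).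
apply/seteqP; split=> [w [Aw Bw] k|w Cw] /=.
  by rewrite /C; case: eqP => [->//|_]; case: eqP => // ->.
split; first by have := Cw i; rewrite /C eqxx.
by have := Cw j; rewrite /C eq_sym (negbTE ij) eqxx.
Qed.

Let intD2 i : P.-integrable setT (fun w => (D w i 0 ^+ 2)%:E).
Proof.
exact: (normal_rv_integrable2 P u _ u0 (mDi i) (normal_vector_coord i)).
Qed.

Lemma normal_vector_integrableM (phi : R -> R) i j : measurable_fun setT phi ->
  (forall x, `|phi x| <= `|x|) ->
  P.-integrable setT (fun w => (D w i 0 * phi (D w j 0))%:E).
Proof.
move=> mphi phi1.
apply: (@le_integrable _ _ _ _ _ _ _
  (fun w => (D w i 0 ^+ 2)%:E + (D w j 0 ^+ 2)%:E)%E) => //.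
- by apply/measurable_EFinP; apply: measurable_funM => //;
  exact: measurableT_comp.
- move=> w _; rewrite -EFinD !abse_EFin lee_fin normrM.
  rewrite [leRHS]ger0_norm ?addr_ge0 ?sqr_ge0//.
  apply: le_trans (ler_wpM2l (normr_ge0 _) (phi1 _)) _.
  rewrite -(real_normK (num_real (D w i 0))) -(real_normK (num_real (D w j 0))).
  have := sqr_ge0 (`|D w i 0| - `|D w j 0|).
  have := normr_ge0 (D w i 0); have := normr_ge0 (D w j 0); nra.
- exact: integrableD.
Qed.

Lemma normal_vector_cross (phi : R -> R) i j :
  i != j -> measurable_fun setT phi ->
  (forall x, `|phi x| <= `|x|) ->
  \int[P]_w (D w i 0 * phi (D w j 0)) = 0.
Proof.
move=> ij mphi phi1; pose psi (z : R * R) := z.2 * phi z.1.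
have mpsi : measurable_fun setT psi.
  by apply: measurable_funM; [exact: measurable_snd|apply:
    measurableT_comp => //; exact: measurable_fst].
have ji : j != i by rewrite eq_sym.
have ipsi : P.-integrable setT (fun w => (psi (D w j 0, D w i 0))%:E).
  exact: normal_vector_integrableM.
have iDi := normal_rv_integrable1 P u _ u0 (mDi i) (normal_vector_coord i).
have ipsi2 x : P.-integrable setT (fun w => (psi (x, D w i 0))%:E).
  rewrite (_ : (fun w => _) = (fun w => (D w i 0)%:E * (phi x)%:E)%E).
    exact: integrableZr.
  by apply/funext => w; rewrite -EFinM.
have := indep_integral P _ _ (mDi j) (mDi i)
  (fun A B mA mB => normal_vector_indep j i A B ji mA mB) psi mpsi ipsi ipsi2.
move=> E; rewrite [LHS]/Rintegral [X in fine X]E integral0_eq// => w _.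
rewrite /psi /= RintegralZr//.
by rewrite (normal_rv_mean0 P u _ u0 (mDi i) (normal_vector_coord i)) mul0r.
Qed.

End normal_vector.

(** * Moments of the weighted increments *)

Lemma Rintegral_sum {R : realType} {disp} {S : measurableType disp}
    (mu : {measure set S -> \bar R}) {I : Type} (r : seq I) (f : I -> S -> R) :
  (forall i, mu.-integrable setT (EFin \o f i)) ->
  \int[mu]_x (\sum_(i <- r) f i x) = \sum_(i <- r) \int[mu]_x f i x.
Proof.
move=> fi; elim: r => [|i r IH].
  by rewrite big_nil; under eq_Rintegral do rewrite big_nil;
    rewrite Rintegral_cst// mul0r.
rewrite big_cons -IH; under eq_Rintegral do rewrite big_cons.
rewrite RintegralD//.
rewrite (_ : EFin \o _ = (fun x => \sum_(i <- r) (f i x)%:E)%E).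
  by apply: integrable_sum => // j _; exact: fi.
by apply/funext => x /=; rewrite sumEFin.
Qed.

(** Compare the sum with the largest term: the fourth power dominates the cube,
    and the maximum is one of the terms. *)
Lemma cube_sum_le {R : realType} {d : nat} (a : 'I_d -> R) :
  (forall i, 0 <= a i) ->
  (1 + \sum_(i < d) a i) ^+ 3 <=
    8 * (1 + d%:R) ^+ 3 * (1 + \sum_(i < d) a i ^+ 4).
Proof.
move=> a0; pose M := \big[Num.max/0]_(i < d) a i.
have aM i : a i <= M by exact: le_bigmax.
have M0 : 0 <= M by exact: bigmax_ge_id.
have SM : 1 + \sum_(i < d) a i <= (1 + d%:R) * (1 + M).
  have : \sum_(i < d) a i <= d%:R * M.
    rewrite mulr_natl -[X in _ *+ X]card_ord -sumr_const.
    by apply: ler_sum => i _; exact: aM.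
  have : 0 <= d%:R :> R by []. lra.
have M4 : M ^+ 4 <= \sum_(i < d) a i ^+ 4.
  have S0 : 0 <= \sum_(i < d) a i ^+ 4 by apply: sumr_ge0 => i _;
    rewrite exprn_ge0.
  rewrite /M; elim/big_ind : _ => [|x y xs ys|i _]; first by rewrite expr0n.
    by rewrite maxEle; case: ifP.
  by rewrite (bigD1 i)//= lerDl sumr_ge0// => j _; rewrite exprn_ge0.
have M3 : (1 + M) ^+ 3 <= 8 * (1 + M ^+ 4).
  have -> : (1 + M) ^+ 3 = 1 + 3 * M + 3 * M ^+ 2 + M * M ^+ 2 by ring.
  have -> : M ^+ 4 = M ^+ 2 * M ^+ 2 by ring.
  have := sqr_ge0 (M - 1); have := sqr_ge0 (M ^+ 2 - 1).
  have : 0 <= M ^+ 2 * (M - 1) ^+ 2 by rewrite mulr_ge0// sqr_ge0.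
  nra.
have S1 : 0 <= 1 + \sum_(i < d) a i by rewrite addr_ge0// sumr_ge0.
apply: (@le_trans _ _ (((1 + d%:R) * (1 + M)) ^+ 3)).
  by rewrite lerXn2r// nnegrE// mulr_ge0// addr_ge0.
rewrite exprMn [leRHS](_ : _ =
  (1 + d%:R) ^+ 3 * (8 * (1 + \sum_(i < d) a i ^+ 4))); last by ring.
rewrite ler_wpM2l ?exprn_ge0 ?addr_ge0//.
by apply: le_trans M3 _; rewrite ler_wpM2l// lerD2l.
Qed.

Section normal_vector_moments.
Context {R : realType} {d : nat} {disp : measure_display}.
Context {Omega : measurableType disp}.
Variables (P : probability Omega R) (u : R) (D : Omega -> 'cV[R]_d).
Hypotheses (u0 : 0 < u) (mD : measurable_fun setT D).
Hypothesis lawD : forall B : 'I_d -> set R, (forall i, measurable (B i)) ->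
  P [set w | forall i, B i (D w i 0)] = (\prod_(i < d) normal_prob 0 u (B i))%E.

Let mDi i : measurable_fun setT (fun w => D w i 0).
Proof. by apply: (measurableT_comp (measurable_mx_coord i 0) mD). Qed.

Let maxr0_le (x : R) : `|Num.max x 0| <= `|x|.
Proof. by have [x0|x0] := leP 0 x; rewrite ?normr0. Qed.

Let minr0_le (x : R) : `|- Num.min x 0| <= `|x|.
Proof. by have [x0|x0] := leP 0 x; rewrite normrN ?normr0. Qed.

Let mmaxr0 : measurable_fun setT (fun x : R => Num.max x 0).
Proof. exact: measurable_maxr. Qed.

Let mminr0 : measurable_fun setT (fun x : R => - Num.min x 0).
Proof. by apply: measurableT_comp => //; exact: measurable_minr. Qed.

(** Off-diagonal terms vanish by independence; on the diagonal the positive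
    and the negative half of the second moment recover the two parts of [g]. *)
Lemma mean_increment_weight (g : 'cV[R]_d) i :
  P.-integrable setT (fun w => (D w i 0 * P1 g ((u ^+ 2)^-1 *: D w))%:E) /\
  \int[P]_w (D w i 0 * P1 g ((u ^+ 2)^-1 *: D w)) = g i 0.
Proof.
have u20 : 0 < u ^+ 2 by rewrite exprn_gt0.
pose p j w := D w i 0 * Num.max (D w j 0) 0.
pose n j w := D w i 0 * - Num.min (D w j 0) 0.
pose a j := 2 / u ^+ 2 * Num.max (g j 0) 0.
pose b j := 2 / u ^+ 2 * - Num.min (g j 0) 0.
have ip j : P.-integrable setT (EFin \o p j).
  exact: (normal_vector_integrableM P u D u0 mD lawD _ i j mmaxr0 maxr0_le).
have in_ j : P.-integrable setT (EFin \o n j).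
  exact: (normal_vector_integrableM P u D u0 mD lawD _ i j mminr0 minr0_le).
have iap j : P.-integrable setT (EFin \o (fun w => a j * p j w)).
  rewrite (_ : EFin \o _ = (fun w => (a j)%:E * (EFin \o p j) w)%E);
    first exact: integrableZl.
  by apply/funext => w; rewrite /= EFinM.
have ibn j : P.-integrable setT (EFin \o (fun w => b j * n j w)).
  rewrite (_ : EFin \o _ = (fun w => (b j)%:E * (EFin \o n j) w)%E);
    first exact: integrableZl.
  by apply/funext => w; rewrite /= EFinM.
have iab j : P.-integrable setT (EFin \o (fun w => a j * p j w + b j * n j w)).
  rewrite (_ : EFin \o _ = (EFin \o (fun w => (a j * p j w)%R)) \+
    (EFin \o (fun w => (b j * n j w)%R)))%E.
    exact: integrableD.
  by apply/funext => w; rewrite /= EFinD.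
have E w : D w i 0 * P1 g ((u ^+ 2)^-1 *: D w) =
  \sum_(j < d) (a j * p j w + b j * n j w).
  rewrite P1_scale// !mulr_sumr; apply: eq_bigr => j _.
  by rewrite /a /b /p /n; ring.
split.
  rewrite (_ : (fun w => _) = (fun w => \sum_(j < d)
    (a j * p j w + b j * n j w)%:E)%E).
    by apply: integrable_sum => // j _; exact: iab.
  by apply/funext => w; rewrite E sumEFin.
under eq_Rintegral do rewrite E.
rewrite Rintegral_sum// (bigD1 i)//= big1 => [|j ji].
  rewrite RintegralD// !RintegralZl// addr0.
  rewrite (normal_rv_positive_half P u _ u0 (mDi i)
    (normal_vector_coord P u D lawD i)).
  rewrite (normal_rv_negative_half P u _ u0 (mDi i)
    (normal_vector_coord P u D lawD i)).
  have gE : g i 0 = Num.max (g i 0) 0 + Num.min (g i 0) 0.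
    by rewrite addr_max_min addr0.
  by rewrite [RHS]gE /a /b; field; rewrite gt_eqF.
rewrite RintegralD// !RintegralZl//; rewrite eq_sym in ji.
rewrite (normal_vector_cross P u D u0 mD lawD _ i j ji mmaxr0 maxr0_le).
rewrite (normal_vector_cross P u D u0 mD lawD _ i j ji mminr0 minr0_le).
by rewrite !mulr0 addr0.
Qed.

(** The constant of [cube_sum_le] applied to the bound on the normalized fourth
    moments. *)
Definition cube_moment_bound : R :=
  8 * (1 + d%:R) ^+ 3 * (1 + d%:R * (64 * Num.sqrt 2)).

Lemma normal_vector_cube_moment :
  P.-integrable setT (fun w => ((1 + (\sum_(i < d) `|D w i 0|) / u) ^+ 3)%:E) /\
  \int[P]_w ((1 + (\sum_(i < d) `|D w i 0|) / u) ^+ 3) <= cube_moment_bound.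
Proof.
pose c : R := 8 * (1 + d%:R) ^+ 3.
have c0 : 0 <= c by rewrite mulr_ge0// exprn_ge0// addr_ge0.
pose q i w := (D w i 0 / u) ^+ 4.
have iq i : P.-integrable setT (EFin \o q i).
  exact: (normal_rv_integrable4 P u _ u0 (mDi i)
    (normal_vector_coord P u D lawD i)).
have isq : P.-integrable setT (EFin \o (fun w => \sum_(i < d) q i w)).
  rewrite (_ : EFin \o _ = (fun w => \sum_(i < d) (q i w)%:E)%E).
    by apply: integrable_sum => // j _; exact: iq.
  by apply/funext => w /=; rewrite sumEFin.
have i1 : P.-integrable setT (EFin \o (fun=> 1 : R)) by exact:
  finite_measure_integrable_cst.
have i1q : P.-integrable setT (EFin \o (fun w => 1 + \sum_(i < d) q i w)).
  rewrite (_ : EFin \o _ = (EFin \o (fun=> 1%R)) \+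
    (EFin \o (fun w => (\sum_(i < d) q i w)%R)))%E.
    exact: integrableD.
  by apply/funext => w; rewrite /= EFinD.
have icq : P.-integrable setT (EFin \o (fun w => c * (1 + \sum_(i < d) q i w))).
  rewrite (_ : EFin \o _ = (fun w => c%:E *
    (EFin \o (fun w => (1 + \sum_(i < d) q i w)%R)) w)%E).
    exact: integrableZl.
  by apply/funext => w; rewrite /= EFinM.
have le w : (1 + (\sum_(i < d) `|D w i 0|) / u) ^+ 3 <=
  c * (1 + \sum_(i < d) q i w).
  have := @cube_sum_le R d (fun i => `|D w i 0| / u)
    (fun i => divr_ge0 (normr_ge0 _) (ltW u0)).
  rewrite -mulr_suml; congr (_ <= c * (1 + _)); apply: eq_bigr => i _.
  by rewrite /q !expr_div_n -normrX ger0_norm// exprn_even_ge0.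
have ic : P.-integrable setT (fun w =>
  ((1 + (\sum_(i < d) `|D w i 0|) / u) ^+ 3)%:E).
  apply: le_integrable icq => //.
    apply/measurable_EFinP; apply: measurable_funX;
      apply: measurable_funD => //.
    apply: measurable_funM => //; apply: measurable_sum => i.
    exact: measurableT_comp.
  move=> w _; rewrite /= lee_fin ger0_norm; last first.
    by rewrite exprn_ge0// addr_ge0// divr_ge0 ?(ltW u0)// sumr_ge0.
  exact: le_trans (le w) (ler_norm _).
split => //.
apply: (@le_trans _ _ (\int[P]_w (c * (1 + \sum_(i < d) q i w)))).
  by apply: le_Rintegral => // w _; exact: le.
rewrite RintegralZl// RintegralD// Rintegral_sum// /cube_moment_bound -/c.
rewrite ler_wpM2l//; apply: lerD.
  rewrite Rintegral_cst// mul1r.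
  by rewrite le_eqVlt; apply/orP; left; apply/eqP;
    exact: (congr1 fine (probability_setT P)).
rewrite mulr_natl -[X in _ *+ X](card_ord d) -sumr_const; apply: ler_sum => i _.
rewrite -lee_fin /Rintegral fineK; last by apply: integrable_fin_num => //;
  exact: iq.
exact: (normal_rv_fourth_moment P u _ u0 (mDi i)
  (normal_vector_coord P u D lawD i)).
Qed.

End normal_vector_moments.

(** * Error over one step *)

Section one_step.
Context {R : realType} {d : nat}.
Variables (T : R) (v : R -> 'cV[R]_d -> R).
Hypothesis Cv : Cb T 2 v.

(** The time increment of [v] and the drift are of order [h], the quadratic
    part of the space increment too, while the weight is of order [h^(-1/2)]:
    what is left after removing the linear diffusive part is [O(h^(1/2))]. *)
Lemma one_step_remainder_le (t u L : R) (x g D b : 'cV[R]_d) (A : 'M[R]_d) :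
  0 <= t -> 0 < u -> t + u ^+ 2 <= T -> 0 <= L ->
  (forall i, `|b i 0| <= L) -> (forall i j, `|A i j| <= L) ->
  (forall i, `|g i 0| <= L) ->
  `|(v (t + u ^+ 2) (x + u ^+ 2 *: b + A *m D) - v t x)
      * P1 g ((u ^+ 2)^-1 *: D)
    - (\sum_(i < d) (A *m D) i 0 * grad T v t x i 0) * P1 g ((u ^+ 2)^-1 *: D)|
  <= 2 * L * (1 + d%:R * L + (d%:R * L) ^+ 2) * (u * (1 + u) ^+ 2
      * (seminorm T 1 0 v + seminorm T 0 1 v + seminorm T 0 2 v))
      * (1 + (\sum_(i < d) `|D i 0|) / u) ^+ 3.
Proof.
move=> t0 u0 tuT L0 bL AL gL.
have u20 : 0 < u ^+ 2 by rewrite exprn_gt0.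
have tT : t \in `[0, T].
  by rewrite in_itv /= t0 (le_trans _ tuT)// lerDl ltW.
set p := P1 _ _; set G := grad T v t x.
set a1 := seminorm T 1 0 v; set a2 := seminorm T 0 1 v;
  set a3 := seminorm T 0 2 v.
have a10 : 0 <= a1 by exact: seminorm_ge0.
have a20 : 0 <= a2 by exact: seminorm_ge0.
have a30 : 0 <= a3 by exact: seminorm_ge0.
pose SD := \sum_(i < d) `|D i 0|; rewrite -/SD; pose S := SD / u.
have SD0 : 0 <= SD by exact: sumr_ge0.
have S0 : 0 <= S by rewrite divr_ge0// ltW.
have SDE : SD = u * S by rewrite /S mulrC divfK// gt_eqF.
rewrite -/S; pose n : R := d%:R; rewrite -/n; have n0 : 0 <= n by [].
have pS : `|p| <= 2 * L * S / u.
  apply: le_trans (P1_le (u ^+ 2) L g D u20 gL) _.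
  rewrite -/SD SDE le_eqVlt; apply/orP; left; apply/eqP; field.
  by rewrite gt_eqF.
pose xi := u ^+ 2 *: b + A *m D.
rewrite -addrA -/xi.
have xiE i : xi i 0 = u ^+ 2 * b i 0 + (A *m D) i 0 by rewrite /xi !mxE.
have AD i : `|(A *m D) i 0| <= L * SD.
  rewrite mxE; apply: le_trans (ler_norm_sum _ _ _) _; rewrite /SD mulr_sumr.
  by apply: ler_sum => k _; rewrite normrM ler_wpM2r.
have xi_le : \sum_(i < d) `|xi i 0| <= n * L * u * ((1 + u) * (1 + S)).
  apply: (@le_trans _ _ (\sum_(i < d) (u ^+ 2 * L + L * SD))).
    apply: ler_sum => i _; rewrite xiE; apply: le_trans (ler_normD _ _) _.
    by rewrite lerD// normrM (gtr0_norm u20) ler_wpM2l// ltW.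
  rewrite sumr_const card_ord -mulr_natl -/n SDE.
  rewrite (_ : n * _ = n * L * u * (u + S)); last by ring.
  rewrite ler_wpM2l ?mulr_ge0// ?(ltW u0)//.
  have : 0 <= u * S by rewrite mulr_ge0// ltW.
  by nra.
pose e1 := v (t + u ^+ 2) (x + xi) - v t (x + xi).
pose e2 := v t (x + xi) - v t x - \sum_(i < d) xi i 0 * G i 0.
pose e3 := \sum_(i < d) u ^+ 2 * b i 0 * G i 0.
have e1_le : `|e1| <= u ^+ 2 * a1.
  exact: (Cb_time_increment_le T v Cv t (u ^+ 2) (x + xi) t0 (ltW u20) tuT).
have e2_le : `|e2| <= a3 * (n * L * u * ((1 + u) * (1 + S))) ^+ 2.
  apply: le_trans (Cb_taylor2 T v Cv t x xi tT) _; rewrite ler_wpM2l//.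
  by rewrite lerXn2r// nnegrE ?sumr_ge0// (le_trans _ xi_le)// sumr_ge0.
have e3_le : `|e3| <= u ^+ 2 * (n * L * a2).
  apply: le_trans (ler_norm_sum _ _ _) _.
  apply: (@le_trans _ _ (\sum_(i < d) u ^+ 2 * (L * a2))).
    apply: ler_sum => i _; rewrite normrM [X in X * _]normrM (gtr0_norm u20)
      -mulrA.
    rewrite ler_wpM2l ?(ltW u20)//; apply: ler_pM => //.
    exact: (grad_le T v Cv t x i tT).
  by rewrite sumr_const card_ord -mulr_natl -/n le_eqVlt; apply/orP; left;
    apply/eqP; ring.
have -> : (v (t + u ^+ 2) (x + xi) - v t x) * p
   - (\sum_(i < d) (A *m D) i 0 * G i 0) * p = (e1 + e2 + e3) * p.
  have -> : e2 = v t (x + xi) - v t x -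
    (e3 + \sum_(i < d) (A *m D) i 0 * G i 0).
    rewrite /e2 /e3 -big_split /=; congr (_ - _); apply: eq_bigr => i _.
    by rewrite xiE mulrDl.
  by rewrite /e1; ring.
rewrite normrM; pose c := 1 + n * L + (n * L) ^+ 2.
pose w := (1 + u) ^+ 2 * (1 + S) ^+ 2.
have nL0 : 0 <= n * L by rewrite mulr_ge0.
have w1 : 1 <= w.
  by rewrite /w mulr_ege1// exprn_ege1// lerDl ?(ltW u0).
have c1 : 1 <= c by rewrite /c -addrA lerDl addr_ge0// sqr_ge0.
have cn : n * L <= c.
  by rewrite /c addrAC lerDr addr_ge0// sqr_ge0.
have cn2 : (n * L) ^+ 2 <= c by rewrite /c lerDr addr_ge0.
have w0 : 0 <= w by exact: le_trans w1.
have c0 : 0 <= c by exact: le_trans c1.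
have sum_le : `|e1 + e2 + e3| <= u ^+ 2 * (c * w * (a1 + a2 + a3)).
  apply: le_trans (ler_normD _ _) _;
    apply: le_trans (lerD (ler_normD _ _) e3_le) _.
  apply: (@le_trans _ _ (u ^+ 2 * (a1 + a3 * ((n * L) ^+ 2 * w) + n * L * a2))).
    rewrite !mulrDr lerD2r lerD//; apply: le_trans e2_le _.
    by rewrite le_eqVlt; apply/orP; left; apply/eqP; rewrite /w; ring.
  rewrite ler_wpM2l ?(ltW u20)// !mulrDr addrAC lerD//; first apply: lerD.
  - by rewrite ler_peMl// mulr_ege1.
  - by rewrite ler_wpM2r// (le_trans cn)// ler_peMr.
  - by rewrite mulrC ler_wpM2r// ler_wpM2r.
apply: le_trans (ler_pM (normr_ge0 _) (normr_ge0 _) sum_le pS) _.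
have -> : u ^+ 2 * (c * w * (a1 + a2 + a3)) * (2 * L * S / u) =
  2 * L * c * (u * (1 + u) ^+ 2 * (a1 + a2 + a3)) * ((1 + S) ^+ 2 * S).
  by rewrite /w; field; rewrite gt_eqF.
have S1 : 0 <= 1 + S by rewrite addr_ge0.
rewrite ler_wpM2l//.
  rewrite mulr_ge0//; first by rewrite !mulr_ge0.
  by rewrite !mulr_ge0 ?addr_ge0 ?exprn_ge0 ?addr_ge0 ?(ltW u0).
by rewrite [leRHS]exprSr ler_wpM2l ?exprn_ge0// lerDr.
Qed.

End one_step.

(** * Conditional expectation over an Euler step *)

Section conditional_expectation.
Context {R : realType} {d : nat} {disp : measure_display}.
Context {Omega : measurableType disp}.
Variable P : probability Omega R.

(** By independence, conditioning on [Z] amounts to freezing it; the identity on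
    an event [Z in B] is the product-law identity for [phi] cut off outside
    [B]. *)
Lemma is_condE_indep {d2 : measure_display} {T2 : measurableType d2}
    (Z : Omega -> 'cV[R]_d) (Y : Omega -> T2) (phi : 'cV[R]_d * T2 -> R) :
  measurable_fun setT Z -> measurable_fun setT Y -> measurable_fun setT phi ->
  (forall A B, measurable A -> measurable B ->
    (P (Z @^-1` A `&` Y @^-1` B) = P (Z @^-1` A) * P (Y @^-1` B))%E) ->
  P.-integrable setT (fun w => (phi (Z w, Y w))%:E) ->
  (forall z, P.-integrable setT (fun w => (phi (z, Y w))%:E)) ->
  is_condE P Z (fun w => phi (Z w, Y w)) (fun z => \int[P]_w phi (z, Y w)).
Proof.
move=> mZ mY mphi ZY iphi iphi2; split => //.
- exact: (indep_measurable_section P Z Y mZ mY ZY phi mphi iphi iphi2).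
- exact: (indep_integrable_section P Z Y mZ mY ZY phi mphi iphi iphi2).
move=> B mB; pose psi (p : 'cV[R]_d * T2) := phi p * \1_B p.1.
have mI : measurable_fun setT (fun p : 'cV[R]_d * T2 => \1_B p.1 : R).
  by apply: (measurableT_comp (f := \1_B : 'cV[R]_d -> R));
    [exact: measurable_indic|exact: measurable_fst].
have mpsi : measurable_fun setT psi by exact: measurable_funM.
have psi_le p : `|psi p| <= `|phi p|.
  by rewrite /psi normrM ler_piMr// indicE; case: (_ \in _);
    rewrite ?normr1 ?normr0.
have mpair : measurable_fun setT (fun w => (Z w, Y w)) by exact:
  measurable_fun_pair.
have ipsi : P.-integrable setT (fun w => (psi (Z w, Y w))%:E).
  apply: le_integrable iphi => //.
  - by apply/measurable_EFinP; exact: (measurableT_comp mpsi mpair).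
  - by move=> w _; rewrite lee_fin psi_le.
have ipsi2 z : P.-integrable setT (fun w => (psi (z, Y w))%:E).
  apply: le_integrable (iphi2 z) => //.
  - apply/measurable_EFinP; apply: (measurableT_comp mpsi).
    exact: measurable_fun_pair.
  - by move=> w _; rewrite lee_fin psi_le.
have patchE_ (g : Omega -> R) :
    (\int[P]_(w in Z @^-1` B) (g w)%:E = \int[P]_w (g w * \1_B (Z w))%:E)%E.
  rewrite integral_mkcond; apply: eq_integral => w _; rewrite patchE indicE.
  have -> : (w \in Z @^-1` B) = (Z w \in B) by apply/idP/idP => /set_mem ?;
    exact/mem_set.
  by case: ifP; rewrite ?mulr1 ?mulr0.
rewrite !patchE_.
have := indep_integral P Z Y mZ mY ZY psi mpsi ipsi ipsi2.
rewrite /psi /= => ->; apply: eq_integral => w _; congr EFin.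
by rewrite RintegralZr//; exact: iphi2.
Qed.

End conditional_expectation.

Section euler_step.
Context {R : realType} {d : nat} {disp : measure_display}.
Context {Omega : measurableType disp}.
Variables (P : probability Omega R) (F : R -> set (set Omega)).
Variable W : R -> Omega -> 'cV[R]_d.
Hypotheses (fF : is_filtration F) (bW : is_brownian P F W).

Lemma rv_in_measurable (t : R) (Z : Omega -> 'cV[R]_d) : 0 <= t ->
  rv_in (F t) Z -> measurable_fun setT Z.
Proof.
move=> t0 FZ _ B mB; rewrite setTI; have [_ Fm _] := fF.
by apply: (Fm t t0); exact: FZ.
Qed.

Lemma brownian_increment_measurable (t h : R) : 0 <= t -> 0 < h ->
  measurable_fun setT (fun w => W (t + h) w - W t w).
Proof.
move=> t0 h0; have [_ _ Wm _ _] := bW.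
have th0 : 0 <= t + h by rewrite addr_ge0// ltW.
apply: measurable_fun_mx => i j.
rewrite (_ : (fun w => _) = (fun w => W (t + h) w i j - W t w i j)).
  apply: measurable_funB.
    exact: (measurableT_comp (measurable_mx_coord i j)
      (rv_in_measurable _ _ th0 (Wm _ th0))).
  exact: (measurableT_comp (measurable_mx_coord i j)
    (rv_in_measurable _ _ t0 (Wm _ t0))).
by apply/funext => w; rewrite !mxE.
Qed.

Variables (f : 'cV[R]_d -> 'cV[R]_d) (sigma : 'cV[R]_d -> 'M[R]_d).
Hypotheses (mf : measurable_fun setT f) (msigma : measurable_fun setT sigma).

Lemma measurable_euler_map (h : R) :
  measurable_fun setT (fun p : 'cV[R]_d * 'cV[R]_d =>
    p.1 + h *: f p.1 + sigma p.1 *m p.2).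
Proof.
apply: measurable_fun_mx => i j.
rewrite (_ : (fun p => _) = (fun p : 'cV[R]_d * 'cV[R]_d =>
  p.1 i j + h * f p.1 i j + \sum_(k < d) sigma p.1 i k * p.2 k j)); last first.
  by apply/funext => p; rewrite !mxE.
have m1 := @measurable_fst _ _ 'cV[R]_d 'cV[R]_d.
have m2 := @measurable_snd _ _ 'cV[R]_d 'cV[R]_d.
apply: measurable_funD; first apply: measurable_funD.
- exact: (measurableT_comp (measurable_mx_coord i j) m1).
- apply: measurable_funM => //.
  exact: (measurableT_comp (measurable_mx_coord i j) (measurableT_comp mf m1)).
- apply: measurable_sum => k; apply: measurable_funM.
    exact: (measurableT_comp (measurable_mx_coord i k)
      (measurableT_comp msigma m1)).
  exact: (measurableT_comp (measurable_mx_coord k j) m2).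
Qed.

Lemma measurable_P1 (h : R) (g : 'cV[R]_d) : 0 < h ->
  measurable_fun setT (fun y : 'cV[R]_d => P1 g (h^-1 *: y)).
Proof.
move=> h0; under eq_fun do rewrite P1_scale//.
apply: measurable_funM => //; apply: measurable_sum => j.
have mj := @measurable_mx_coord R d 1 j 0.
apply: measurable_funD; apply: measurable_funM => //.
  exact: measurable_maxr.
by apply: measurableT_comp => //; exact: measurable_minr.
Qed.

Variables (T h t : R) (v : R -> 'cV[R]_d -> R) (g : 'cV[R]_d) (L : R).
Hypotheses (h0 : 0 < h) (gridt : grid T h t) (Cv : Cb T 2 v).
Hypotheses (L0 : 0 <= L) (gL : forall i, `|g i 0| <= L).

Lemma grid_ge0 : 0 <= t.
Proof. by case: gridt => k -> _; rewrite mulr_ge0// ltW. Qed.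

Lemma grid_leT : t + h <= T.
Proof. by case: gridt => k _; rewrite lerBrDr. Qed.

Let D w := W (t + h) w - W t w.
Let u := Num.sqrt h.
Let u0 : 0 < u. Proof. by rewrite sqrtr_gt0. Qed.
Let uh : u ^+ 2 = h. Proof. by rewrite sqr_sqrtr// ltW. Qed.
Let mD : measurable_fun setT D.
Proof. exact: brownian_increment_measurable grid_ge0 h0. Qed.

Lemma brownian_increment_law (B : 'I_d -> set R) :
  (forall i, measurable (B i)) ->
  P [set w | forall i, B i (D w i 0)] = (\prod_(i < d) normal_prob 0 u (B i))%E.
Proof.
move=> mB; have [_ _ _ _ lawW] := bW.
have tth : t < t + h by rewrite ltrDl.
by rewrite (lawW t (t + h) grid_ge0 tth B mB) addrAC subrr add0r.
Qed.

Let S w := 1 + (\sum_(i < d) `|D w i 0|) / u.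

(** A function of the pair formed by the state before the step and the Brownian
    increment, since these two are independent. *)
Definition weighted_increment (x : 'cV[R]_d) (p : 'cV[R]_d * 'cV[R]_d) : R :=
  (v (t + h) (p.1 + h *: f p.1 + sigma p.1 *m p.2) - v t x) *
  P1 g (h^-1 *: p.2).

Let thT : t + h \in `[0, T].
Proof. by rewrite in_itv /= grid_leT andbT addr_ge0 ?grid_ge0// ltW. Qed.

Let tT : t \in `[0, T].
Proof. by rewrite in_itv /= grid_ge0 (le_trans _ grid_leT)// lerDl ltW. Qed.

Lemma measurable_weighted_increment x :
  measurable_fun setT (weighted_increment x).
Proof.
apply: measurable_funM.
  apply: measurable_funB => //.
  have mv : measurable_fun setT (v (t + h)).
    by apply: continuous_measurable_mx;
      exact: (Cb_continuous_space T v Cv _ thT).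
  exact: (measurableT_comp mv (measurable_euler_map h)).
exact: (measurableT_comp (measurable_P1 h g h0) measurable_snd).
Qed.

Lemma weighted_increment_le x : exists c : R, forall z w,
  `|weighted_increment x (z, D w)| <= c * S w ^+ 3.
Proof.
have [_ /(_ [::] isT) [_ [B Bv]]] := Cv.
exists (2 * B * (2 / h * L * u)) => z w; rewrite /weighted_increment /= normrM.
have B0 : 0 <= B by apply: le_trans (Bv t 0 tT).
rewrite -mulrA; apply: ler_pM => //.
  apply: le_trans (ler_normB _ _) _; rewrite mulr_natl mulr2n.

  apply: lerD; [exact: (Bv (t + h) _ thT)|exact: (Bv t _ tT)].
apply: le_trans (P1_le h L g (D w) h0 gL) _.
have SuE : \sum_(i < d) `|D w i 0| = u * ((\sum_(i < d) `|D w i 0|) / u).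
  by rewrite mulrC divfK// gt_eqF.
rewrite {1}SuE mulrA ler_wpM2l ?mulr_ge0 ?invr_ge0 ?(ltW h0) ?(ltW u0)//.
have S0 : 0 <= (\sum_(i < d) `|D w i 0|) / u by rewrite divr_ge0 ?(ltW u0)//
  sumr_ge0.
rewrite /S; set s := _ / u; have s1 : 1 <= 1 + s by rewrite lerDl.
apply: (@le_trans _ _ (1 + s)); first by rewrite lerDr.
by rewrite exprS ler_peMr ?exprn_ege1// (le_trans _ s1).
Qed.

Lemma integrable_weighted_increment x (Z : Omega -> 'cV[R]_d) :
  measurable_fun setT Z ->
  P.-integrable setT (fun w => (weighted_increment x (Z w, D w))%:E).
Proof.
move=> mZ; have [c cS] := weighted_increment_le x.
have [iS _] := normal_vector_cube_moment P u D u0 mD brownian_increment_law.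
have icS : P.-integrable setT (fun w => (c * S w ^+ 3)%:E).
  rewrite (_ : (fun w => _) = (fun w => c%:E * (S w ^+ 3)%:E)%E);
    first exact: integrableZl.
  by apply/funext => w; rewrite EFinM.
apply: le_integrable icS => //.
  apply/measurable_EFinP; apply:
    (measurableT_comp (measurable_weighted_increment x)).
  exact: measurable_fun_pair.
by move=> w _; rewrite /= lee_fin (le_trans (cS _ _))// ler_norm.
Qed.

(** The state at time [t] is known at time [t], the increment is independent of
    it, and the version of the conditional expectation obtained by freezing is
    the same for all the laws of that state. *)
Lemma euler_condE_weighted_increment x :
  euler_condE P F W T h f sigma t
    (fun X w => (v (t + h) (X (t + h) w) - v t x) *
       P1 g (h^-1 *: (W (t + h) w - W t w)))
    (fun z => \int[P]_w weighted_increment x (z, D w)).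
Proof.
move=> X [FX stepX]; have t0 := grid_ge0.
have mX := rv_in_measurable t (X t) t0 FX.
have XD A B : measurable A -> measurable B ->
    (P (X t @^-1` A `&` D @^-1` B) = P (X t @^-1` A) * P (D @^-1` B))%E.
  move=> mA mB; have [_ _ _ indepW _] := bW.
  by apply: (indepW t (t + h)) => //; [rewrite ltrDl|exact: FX].
rewrite (_ : (fun w => _) = (fun w => weighted_increment x (X t w, D w)));
  last first.
  by apply/funext => w; rewrite (stepX t gridt (lexx t) w).
apply: is_condE_indep => //.
- exact: measurable_weighted_increment.
- exact: integrable_weighted_increment.
- by move=> z; exact: integrable_weighted_increment.
Qed.

(** The only part of the increment that is not negligible: it reduces to
    [mean_increment_weight] by linearity. *)
Lemma mean_linear_part (A : 'M[R]_d) (G : 'cV[R]_d) :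
  let f0 w := (\sum_(i < d) (A *m D w) i 0 * G i 0) * P1 g (h^-1 *: D w) in
  P.-integrable setT (EFin \o f0) /\ \int[P]_w f0 w = dotp (A *m g) G.
Proof.
move=> f0; pose e k := \sum_(i < d) A i k * G i 0.
pose q k w := D w k 0 * P1 g (h^-1 *: D w).
have exch (y : 'cV[R]_d) : \sum_(i < d) (A *m y) i 0 * G i 0 =
  \sum_(k < d) e k * y k 0.
  under eq_bigr do rewrite mxE mulr_suml.
  rewrite exchange_big /=; apply: eq_bigr => k _; rewrite /e mulr_suml.
  by apply: eq_bigr => i _; rewrite mulrAC.
have iq k : P.-integrable setT (EFin \o q k) /\ \int[P]_w q k w = g k 0.
  by rewrite /q -uh; exact: (mean_increment_weight P u D u0 mD
    brownian_increment_law g k).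
have ieq k : P.-integrable setT (EFin \o (fun w => e k * q k w)).
  rewrite (_ : EFin \o _ = (fun w => (e k)%:E * (EFin \o q k) w)%E).
    by apply: integrableZl => //; exact: (iq k).1.
  by apply/funext => w; rewrite /= EFinM.
have f0E : f0 = (fun w => \sum_(k < d) e k * q k w).
  apply/funext => w; rewrite /f0 exch mulr_suml.
  by apply: eq_bigr => k _; rewrite /q mulrA.
rewrite f0E; split.
  rewrite (_ : EFin \o _ = (fun w => \sum_(k < d) (e k * q k w)%:E)%E).
    by apply: integrable_sum => // k _; exact: ieq.
  by apply/funext => w /=; rewrite sumEFin.
rewrite Rintegral_sum// /dotp exch; apply: eq_bigr => k _.
by rewrite RintegralZl// ?(iq k).2//; exact: (iq k).1.
Qed.

Hypothesis fL : forall x i, `|f x i 0| <= L.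
Hypothesis sigmaL : forall x i j, `|sigma x i j| <= L.

Lemma weighted_increment_error x :
  `|dotp (sigma x *m g) (grad T v t x) -
    \int[P]_w weighted_increment x (x, D w)|
  <= 2 * L * (1 + d%:R * L + (d%:R * L) ^+ 2) * @cube_moment_bound R d *
     (Num.sqrt h * (1 + Num.sqrt h) ^+ 2
      * (seminorm T 1 0 v + seminorm T 0 1 v + seminorm T 0 2 v)).
Proof.
have [] := mean_linear_part (sigma x) (grad T v t x).
set f0 := (f0 in EFin \o f0) => if0 <-.
have iw := integrable_weighted_increment x (fun=> x) (measurable_cst x).
have [iS S3] := normal_vector_cube_moment P u D u0 mD brownian_increment_law.
set k := 2 * L * _; set a := _ * (seminorm _ _ _ _ + _ + _).
have k0 : 0 <= k by rewrite /k !mulr_ge0// addr_ge0 ?sqr_ge0// addr_ge0//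
  mulr_ge0.
have a0 : 0 <= a.
  by rewrite /a !mulr_ge0 ?exprn_ge0 ?addr_ge0 ?seminorm_ge0 ?(ltW u0).
rewrite distrC -RintegralB//.
have idiff : P.-integrable setT
  (EFin \o (fun w => weighted_increment x (x, D w) - f0 w)).
  rewrite (_ : EFin \o _ = (fun w => (weighted_increment x (x, D w))%:E -
    (f0 w)%:E)%E).
    exact: (integrableB measurableT iw if0).
  by apply/funext => w; rewrite /= EFinB.
apply: le_trans (le_normr_Rintegral measurableT idiff) _.
apply: (@le_trans _ _ (\int[P]_w (k * a * S w ^+ 3))).
  apply: le_Rintegral => //.
  - exact: (integrable_norm idiff).
  - rewrite (_ : EFin \o _ = (fun w => (k * a)%:E * (S w ^+ 3)%:E)%E);
    first exact: integrableZl.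
    by apply/funext => w; rewrite /= EFinM.
  move=> w _; have := one_step_remainder_le T v Cv t u L x g (D w) (f x)
    (sigma x)
    grid_ge0 u0.
  by rewrite uh => /(_ grid_leT L0 (fL x) (sigmaL x) gL).
by rewrite RintegralZl// mulrAC ler_wpM2r// ler_wpM2l.
Qed.

End euler_step.

(** * The weak approximation of the gradient *)

Theorem theorem3p3 (R : realType) (d : nat) (d_ge1 : (1 <= d)%N)
    (N : 'cV[R]_d -> R) (NM : 'M[R]_d -> R)
    (N_norm : is_norm N) (NM_norm : is_norm NM) (C M : R) :
  exists2 K : R, 0 < K &
  forall (disp : measure_display) (Omega : measurableType disp)
    (P : probability Omega R) (F : R -> set (set Omega))
    (W : R -> Omega -> 'cV[R]_d),
  is_filtration F -> is_brownian P F W ->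
  forall T h : R, 0 < T -> 0 < h -> T / h \is a Num.nat ->
  forall (f : 'cV[R]_d -> 'cV[R]_d) (sigma : 'cV[R]_d -> 'M[R]_d),
  measurable_fun setT f -> measurable_fun setT sigma ->
  (forall x, N (f x) <= C) -> (forall x, NM (sigma x) <= C) ->
  forall g : 'cV[R]_d, N g <= M ->
  forall v : R -> 'cV[R]_d -> R, Cb T 2 v ->
  forall (t : R) (x : 'cV[R]_d), grid T h t ->
  exists2 m : 'cV[R]_d -> R,
    euler_condE P F W T h f sigma t
      (fun X w => (v (t + h) (X (t + h) w) - v t x)
                  * P1 g (h^-1 *: (W (t + h) w - W t w))) m &
    `|dotp (sigma x *m g) (grad T v t x) - m x|
    <= K * (1 + Num.sqrt h) ^+ 2
       * (Num.sqrt h * (seminorm T 1 0 v + seminorm T 0 1 v + seminorm T 0 2 v)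
          + h * seminorm T 1 1 v
          + h * Num.sqrt h * seminorm T 2 0 v).
Proof.
have [c1 c10 Nc] := is_norm_dominates_entries N N_norm.
have [c2 c20 NMc] := is_norm_dominates_entries NM NM_norm.
(* a common bound for the entries of [f], [sigma] and [g] *)
pose L := c1 * (`|C| + `|M|) + c2 * `|C|.
have L0 : 0 <= L by rewrite addr_ge0// mulr_ge0// addr_ge0.
pose k := 2 * L * (1 + d%:R * L + (d%:R * L) ^+ 2) * @cube_moment_bound R d.
have cube0 : 0 <= @cube_moment_bound R d.
  by rewrite !mulr_ge0 ?exprn_ge0 ?addr_ge0 ?mulr_ge0 ?sqrtr_ge0.
have k0 : 0 <= k by rewrite /k !mulr_ge0// addr_ge0 ?sqr_ge0// addr_ge0//
  mulr_ge0.
(* [+ 1] because [k] may be zero *)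
exists (k + 1); first by rewrite ltr_wpDl.
move=> disp Omega P F W fF bW T h T0 h0 _ f sigma mf ms fC sC g gM v Cv t x gt.
have fL y i : `|f y i 0| <= L.
  apply: le_trans (Nc (f y) i 0) _.
  apply: (@le_trans _ _ (c1 * (`|C| + `|M|))); last by rewrite lerDl mulr_ge0.
  by rewrite ler_wpM2l// (le_trans (fC y))// (le_trans (ler_norm C))// lerDl.
have sL y i j : `|sigma y i j| <= L.
  apply: le_trans (NMc (sigma y) i j) _.
  apply: (@le_trans _ _ (c2 * `|C|)); last by rewrite lerDr mulr_ge0// addr_ge0.
  by rewrite ler_wpM2l// (le_trans (sC y))// ler_norm.
have gL i : `|g i 0| <= L.
  apply: le_trans (Nc g i 0) _.
  apply: (@le_trans _ _ (c1 * (`|C| + `|M|))); last by rewrite lerDl mulr_ge0.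
  by rewrite ler_wpM2l// (le_trans gM)// (le_trans (ler_norm M))// lerDr.
exists (fun z => \int[P]_w weighted_increment f sigma h t v g x
  (z, W (t + h) w - W t w)).
  exact: (euler_condE_weighted_increment P F W fF bW f sigma mf ms T h t v g L).
apply: le_trans (weighted_increment_error P F W fF bW f sigma mf ms T h t v g L
  h0 gt Cv L0 gL fL sL x) _.
have hs : 0 <= Num.sqrt h by exact: sqrtr_ge0.
set a := seminorm T 1 0 v + _ + _.
have a0 : 0 <= a by rewrite !addr_ge0 ?seminorm_ge0.
rewrite -/k (_ : k * _ = k * ((1 + Num.sqrt h) ^+ 2 * (Num.sqrt h * a)));
  last by ring.
have b0 : 0 <= (1 + Num.sqrt h) ^+ 2 by rewrite sqr_ge0.
rewrite -[leRHS]mulrA; apply: ler_pM => //.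
- by rewrite !mulr_ge0.
- by rewrite lerDl.
rewrite ler_wpM2l// -addrA lerDl.
by rewrite addr_ge0// !mulr_ge0 ?seminorm_ge0 ?(ltW h0).
Qed.
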